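(* Let $s\geq 3$ and $k\geq 2$ be integers. There is a constant $N$ such that for all $n\ge N$, $$\mathrm{sat}(n, M_k, K_s)=N(M_k, S_{n,s-2}).$$ Moreover, if $k\le s-2$ then, for all $n\ge N$, $S_{n,s-2}$ is the unique $n$-vertex $K_s$-saturated graph $G$ with $N(M_k,G)=\mathrm{sat}(n,M_k,K_s)$. In addition, for $s=3$ and $k=2$, $S_{n,1}$ is the unique $n$-vertex $K_3$-saturated graph $G$ with $N(M_2,G)=\mathrm{sat}(n,M_2,K_3)$.
   Context: For a fixed graph $F$, a graph $G$ is $F$-saturated if $G$ contains no subgraph isomorphic to $F$, but adding any edge not already in $G$ creates a subgraph isomorphic to $F$. For graphs $H,G$, $N(H,G)$ denotes the number of subgraphs of $G$ isomorphic to $H$ (copies of $H$ in $G$). The generalized saturation number is $\mathrm{sat}(n,H,F)=\min\{N(H,G): G \text{ is an } n\text{-vertex } F\text{-saturated graph}\}$. $M_k$ denotes a matching consisting of $k$ edges (i.e., $k$ pairwise vertex-disjoint edges). $K_s$ is the complete graph on $s$ vertices. $S_{n,k}$ is the join of a complete graph $K_k$ and an empty (edgeless) graph on $n-k$ vertices, i.e., the $n$-vertex graph with a clique of size $k$ joined to every vertex of an independent set of size $n-k$. *)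

(* Defs.v *)
From mathcomp Require Import all_boot.

Set Implicit Arguments.
Unset Strict Implicit.
Unset Printing Implicit Defensive.

Record graph (V : finType) := Graph {
  adj :> rel V;
  adj_sym : symmetric adj;
  adj_irr : irreflexive adj }.

Definition edges (V : finType) (G : graph V) : {set {set V}} :=
  [set [set p.1; p.2] | p : V * V & adj G p.1 p.2].

Definition isomorphic (U V : finType) (H : graph U) (G : graph V) : Prop :=
  exists2 f : U -> V, bijective f & forall x y, adj G (f x) (f y) = adj H x y.

(* A candidate subgraph is a pair S = (vertex set, edge set). *)
Definition is_subgraph (V : finType) (G : graph V)
    (S : {set V} * {set {set V}}) : bool :=
  (S.2 \subset edges G) && [forall e in S.2, e \subset S.1].

Definition subgraph_iso (U V : finType) (H : graph U)
    (S : {set V} * {set {set V}}) : bool :=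
  [exists f : {ffun U -> V},
    [&& injectiveb f, S.1 == f @: [set: U]
      & S.2 == [set f @: (e : {set U}) | e in edges H]]].

(* Subgraphs, not embeddings: each copy is counted once, whatever the number
   of automorphisms of H. *)
Definition copies (U V : finType) (H : graph U) (G : graph V) :
    {set {set V} * {set {set V}}} :=
  [set S | is_subgraph G S && subgraph_iso H S].

Definition num_copies (U V : finType) (H : graph U) (G : graph V) : nat :=
  #|copies H G|.

Definition contains (U V : finType) (F : graph U) (G : graph V) : Prop :=
  exists S, S \in copies F G.

Section AddEdge.
Variables (V : finType) (G : graph V) (x y : V).

Definition add_edge_rel : rel V :=
  fun a b => adj G a b || (a != b) && ([set a; b] == [set x; y]).

Lemma add_edge_sym : symmetric add_edge_rel.
Proof. by move=> a b; rewrite /add_edge_rel adj_sym eq_sym setUC. Qed.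

Lemma add_edge_irr : irreflexive add_edge_rel.
Proof. by move=> a; rewrite /add_edge_rel adj_irr eqxx. Qed.

Definition add_edge : graph V := Graph add_edge_sym add_edge_irr.
End AddEdge.

Definition saturated (U V : finType) (F : graph U) (G : graph V) : Prop :=
  ~ contains F G /\
  forall x y : V, x != y -> ~~ adj G x y -> contains F (add_edge G x y).

(* [is_sat n H F m] reads sat(n, H, F) = m.  It is a relation because the
   minimum is undefined when no n-vertex F-saturated graph exists. *)
Definition is_sat (n : nat) (U W : finType) (H : graph U) (F : graph W)
    (m : nat) : Prop :=
  (exists2 G : graph 'I_n, saturated F G & num_copies H G = m) /\
  (forall G : graph 'I_n, saturated F G -> m <= num_copies H G).

Lemma is_sat_unique n (U W : finType) (H : graph U) (F : graph W) m1 m2 :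
  is_sat n H F m1 -> is_sat n H F m2 -> m1 = m2.
Proof.
move=> [[G1 s1 <-] min1] [[G2 s2 <-] min2].
by apply/eqP; rewrite eqn_leq min1 // min2.
Qed.

Definition sat_extremal (n : nat) (U W : finType) (H : graph U) (F : graph W)
    (G : graph 'I_n) : Prop :=
  saturated F G /\ is_sat n H F (num_copies H G).

Section Complete.
Variable s : nat.

Definition complete_rel : rel 'I_s := fun i j => i != j.

Lemma complete_sym : symmetric complete_rel.
Proof. by move=> i j; rewrite /complete_rel eq_sym. Qed.

Lemma complete_irr : irreflexive complete_rel.
Proof. by move=> i; rewrite /complete_rel eqxx. Qed.

Definition complete : graph 'I_s := Graph complete_sym complete_irr.
End Complete.

(* The i-th edge of the matching joins (i, false) and (i, true). *)
Section Matching.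
Variable k : nat.

Definition matching_rel : rel ('I_k * bool) :=
  fun p q => (p.1 == q.1) && (p.2 != q.2).

Lemma matching_sym : symmetric matching_rel.
Proof. by move=> p q; rewrite /matching_rel eq_sym [p.2 == _]eq_sym. Qed.

Lemma matching_irr : irreflexive matching_rel.
Proof. by move=> p; rewrite /matching_rel !eqxx. Qed.

Definition matching : graph ('I_k * bool)%type :=
  Graph matching_sym matching_irr.
End Matching.

(* S_{n,k}: the vertices i < k form the clique K_k, the vertices i >= k the
   independent set; meaningful for k <= n. *)
Section CliqueJoinEmpty.
Variables n k : nat.

Definition clique_join_empty_rel : rel 'I_n :=
  fun i j => (i != j) && ((i < k) || (j < k)).

Lemma clique_join_empty_sym : symmetric clique_join_empty_rel.
Proof. by move=> i j; rewrite /clique_join_empty_rel eq_sym orbC. Qed.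

Lemma clique_join_empty_irr : irreflexive clique_join_empty_rel.
Proof. by move=> i; rewrite /clique_join_empty_rel eqxx. Qed.

Definition clique_join_empty : graph 'I_n :=
  Graph clique_join_empty_sym clique_join_empty_irr.
End CliqueJoinEmpty.

(* Main.v *)
Require Import Defs.
From mathcomp Require Import all_boot.
From mathcomp Require Import order ssralg ssrnum rat.
From mathcomp Require Import zify.

Set Implicit Arguments.
Unset Strict Implicit.
Unset Printing Implicit Defensive.

(** Put m = s - 2.  For k > m the graph S_{n,m} has no k-matching, so only
  k <= m needs work.  Bollobas's set-pair inequality, applied to the non-edges
  {x, y} of a K_s-saturated graph G and the complements of the cliques they
  would complete, shows that G has at least as many edges as S_{n,m}.  This
  many edges already force at least as many k-matchings as S_{n,m} has, once n
  is large.

  Choosing disjoint edges greedily gives about n^k * m (m-1) ... (m-k+1) / k!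
  matchings, which is already the leading term for S_{n,m}; there is a surplus
  of order n^k unless m vertices have degree at least n - T, where T is a small
  fraction of n.  Deleting these m vertices one by one and comparing with the
  same recursion for S_{n,m}, every edge missing at one of them is paid for by
  an edge elsewhere, which lies in about C(m, k-1) n^(k-1) matchings, whereas
  the missing edge lies in only C(m-1, k-1) n^(k-1).  So equality forces the m
  vertices to be adjacent to everything, and then G = S_{n,m} as G is K_s-free.
*)


(** * Matchings in a set of pairs, and deletion of a vertex *)

Section Matchings.
Variable V : finType.
Implicit Types (E M : {set {set V}}) (e : {set V}) (v : V) (U B : {set V}).

(** Edge sets are bare families of sets over a fixed [V], so that deleting a vertex means passing
    from [E] and [U] to [E :\: star E v] and [U :\ v] without changing the vertex type. *)
Definition matchings E k : {set {set {set V}}} :=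
  [set M : {set {set V}} | [&& M \subset E, trivIset M & #|M| == k]].

Definition star E v : {set {set V}} := [set e in E | v \in e].

Definition pairs U : {set {set V}} := [set e : {set V} | (e \subset U) && (#|e| == 2)].

Lemma matchings_sub E1 E2 k :
  E1 \subset E2 -> #|matchings E1 k| <= #|matchings E2 k|.
Proof.
move=> s12; apply: subset_leq_card; apply/subsetP => M.
rewrite !inE => /andP[sM ->]; by rewrite (subset_trans sM s12).
Qed.

Lemma matchings0 E : #|matchings E 0| = 1.
Proof.
rewrite -(cards1 (set0 : {set {set V}})); apply: eq_card => M.
rewrite !inE cards_eq0; apply/idP/eqP => [/and3P[_ _ /eqP->//]|->].
by rewrite sub0set eqxx andbT; apply/trivIsetP => A B; rewrite inE.
Qed.

Lemma matchings1E E : matchings E 1 = [set [set e] | e in E].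
Proof.
apply/setP => M; rewrite inE; apply/and3P/imsetP.
  move=> [sM _ /cards1P[e eM]]; exists e => //.
  by apply: (subsetP sM); rewrite eM set11.
move=> [e eE ->]; rewrite cards1 sub1set eE; split=> //.
by apply/trivIsetP => A B; rewrite !inE => /eqP-> /eqP->; rewrite eqxx.
Qed.

Lemma matchings_lt E k : #|E| < k -> #|matchings E k| = 0.
Proof.
move=> lt; apply/eqP; rewrite cards_eq0; apply/eqP/setP => M; rewrite !inE.
apply/negP => /and3P[/subset_leq_card sM _ /eqP eM].
by rewrite eM leqNgt lt in sM.
Qed.

Lemma pairs_sub U E M : E \subset pairs U -> M \subset E ->
  forall e, e \in M -> e \subset U /\ #|e| = 2.
Proof.
move=> sE sM e /(subsetP sM)/(subsetP sE); rewrite inE.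
by move=> /andP[? /eqP].
Qed.

Lemma card_cover_matching U E k M : E \subset pairs U ->
  M \in matchings E k -> #|cover M| = k.*2.
Proof.
move=> sE; rewrite inE => /and3P[sM tM /eqP<-].
move: tM; rewrite /trivIset => /eqP<-.
rewrite (eq_bigr (fun=> 2)); last by move=> e /(pairs_sub sE sM)[].
by rewrite sum_nat_const muln2.
Qed.

(** The empty set is disjoint from itself, so [e \notin M] rests on [e] being nonempty. *)
Lemma trivIsetU1 e M : #|e| != 0 -> trivIset M -> [disjoint e & cover M] ->
  trivIset (e |: M) /\ e \notin M.
Proof.
move=> e0 tM dM.
have eM A : A \in M -> [disjoint e & A].
  by move=> AM; apply: disjointWr dM; apply: (bigcup_sup A).
split; last first.
  apply/negP => /eM; rewrite -setI_eq0 setIid => /eqP e00.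
  by rewrite e00 cards0 in e0.
apply/trivIsetP => A B; rewrite !inE => /orP[/eqP->|AM] /orP[/eqP->|BM].
- by rewrite eqxx.
- by move=> _; exact: eM.
- by move=> _; rewrite disjoint_sym; exact: eM.
- exact: (trivIsetP tM).
Qed.

(** A matching either misses [v] or splits uniquely into its edge at [v] and a matching of the graph
    without [v] that is disjoint from this edge. *)
Lemma matchings_vertex U E v k : E \subset pairs U ->
  #|matchings E k.+1| = #|matchings (E :\: star E v) k.+1| +
    \sum_(M in matchings (E :\: star E v) k)
       #|[set e in star E v | [disjoint e & cover M]]|.
Proof.
move=> sE; set E' := E :\: star E v.
have E'P e : (e \in E') = (v \notin e) && (e \in E).
  by rewrite !inE; case: (e \in E); rewrite ?andbF ?andbT.
have sE' : E' \subset E by apply: subsetDl.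
pose X := [set M in matchings E k.+1 | v \in cover M].
have -> : #|matchings E k.+1| = #|matchings E' k.+1| + #|X|.
  rewrite -(cardsID [set M | v \in cover M]) addnC; congr (_ + _); apply: eq_card => M.
    rewrite !inE; case: (boolP (M \subset E')) => sM /=.
      rewrite (subset_trans sM sE') andTb; case: (boolP (v \in cover M)) => //.
      by move=> /bigcupP[e /(subsetP sM)]; rewrite E'P => /andP[/negP].
    apply/negP => /andP[nv /and3P[sME _ _]]; case/negP: sM.
    apply/subsetP => e eM; rewrite E'P (subsetP sME) // andbT.
    by apply: contra nv => ve; apply/bigcupP; exists e.
  by rewrite !inE andbC.
congr (_ + _).
pose D := [set p : {set {set V}} * {set V} |
   (p.1 \in matchings E' k) && (p.2 \in [set e in star E v | [disjoint e & cover p.1]])].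
have nvcov M : M \subset E' -> v \notin cover M.
  by move=> sM; apply/negP => /bigcupP[e /(subsetP sM)]; rewrite E'P => /andP[/negP].
transitivity #|D|.
  (* The edge [e] is the only member of [e |: M] containing [v], so filtering on [v] recovers both
     components. *)
  have inj : {in D &, injective (fun p : {set {set V}} * {set V} => p.2 |: p.1)}.
    have aux (M : {set {set V}}) (e : {set V}) : (M, e) \in D -> [set A in e |: M | v \in A] = [set e].
      rewrite !inE /= => /andP[/and3P[sM _ _] /andP[/andP[_ ve] _]].
      apply/setP => A; rewrite !inE; apply/idP/eqP => [|->]; last by rewrite eqxx.
      case/andP=> /orP[/eqP//|AM] vA.
      by move: (subsetP sM _ AM); rewrite E'P vA.
    have aux2 (M : {set {set V}}) (e : {set V}) : (M, e) \in D -> [set A in e |: M | v \notin A] = M.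
      rewrite !inE /= => /andP[/and3P[sM _ _] /andP[/andP[_ ve] _]].
      apply/setP => A; rewrite !inE; apply/idP/idP => [|AM].
        by case/andP=> /orP[/eqP->|//]; rewrite ve.
      by move: (subsetP sM _ AM); rewrite AM E'P orbT => /andP[-> _].
    move=> [M1 e1] [M2 e2] D1 D2 /= eq12; congr (_, _).
      by rewrite -(aux2 _ _ D1) -(aux2 _ _ D2) eq12.
    by apply: set1_inj; rewrite -(aux _ _ D1) -(aux _ _ D2) eq12.
  rewrite -(card_in_imset inj); apply: eq_card => M; rewrite inE.
  apply/andP/imsetP.
    rewrite inE => -[/and3P[sM tM /eqP cM] vM].
    have /bigcupP[e eM ve] := vM.
    exists (M :\ e, e); last by rewrite /= setD1K.
    rewrite !inE /= ve (subsetP sM _ eM) /=.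
    rewrite (trivIsetS (subD1set _ _) tM) /=.
    have -> : #|M :\ e| == k by move: cM; rewrite (cardsD1 e) eM; lia.
    have dj A : A \in M :\ e -> [disjoint e & A].
      rewrite !inE => /andP[ne AM]; apply: (trivIsetP tM) => //.
      by rewrite eq_sym.
    rewrite andbT; apply/andP; split.
      apply/subsetP => A AMe; rewrite E'P; move: (AMe); rewrite !inE => /andP[_ AM].
      rewrite (subsetP sM) // andbT; apply/negP => vA.
      by move: (disjointFr (dj _ AMe) ve); rewrite vA.
    rewrite -setI_eq0; apply/eqP/setP => x; rewrite !inE; apply/negP.
    move=> /andP[xe /bigcupP[A AMe xA]].
    by move: (disjointFr (dj _ AMe) xe); rewrite xA.
  move=> [[M' e]]; rewrite !inE /= => /andP[/and3P[sM tM /eqP cM] /andP[/andP[eE ve] dM]] ->.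
  have e0 : #|e| != 0 by apply/negP; rewrite cards_eq0 => /eqP e0; move: ve; rewrite e0 inE.
  have [t n] := trivIsetU1 e0 tM dM.
  split; last by apply/bigcupP; exists e => //; rewrite setU11.
  apply/and3P; split=> //; last by rewrite cardsU1 n cM.
  by rewrite subUset sub1set eE (subset_trans sM sE').
rewrite -sum1_card (eq_bigr (fun M => \sum_(e in [set e in star E v | [disjoint e & cover M]]) 1)).
  by rewrite pair_big_dep /=; apply: eq_bigl => p; rewrite inE.
by move=> M _; rewrite sum1_card.
Qed.

Lemma pair_other U E e v : E \subset pairs U -> e \in star E v ->
  exists2 u, e = [set v; u] & u != v.
Proof.
move=> sE; rewrite inE => /andP[/(subsetP sE)]; rewrite inE => /andP[_ /cards2P[x] [y] [xy ->]].
rewrite !inE => /orP[] /eqP ->; first by exists y => //; rewrite eq_sym.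
by exists x => //; rewrite setUC.
Qed.

(** An edge at [v] is determined by its other endpoint, which must lie in [W] if the edge meets
    [W]. *)
Lemma card_star_meet U E v (W : {set V}) : E \subset pairs U -> v \notin W ->
  #|[set e in star E v | ~~ [disjoint e & W]]| <= #|W|.
Proof.
move=> sE nv; apply: leq_trans (leq_imset_card (fun u => [set v; u]) W).
apply: subset_leq_card; apply/subsetP => e; rewrite inE => /andP[/(pair_other sE)[u -> _]].
rewrite -setI_eq0 => /set0Pn[x]; rewrite !inE => /andP[/orP[]/eqP-> xW].
  by rewrite xW in nv.
by apply: imset_f.
Qed.

Lemma card_star_disjoint U E v (W : {set V}) : E \subset pairs U -> v \in U ->
  W \subset U :\ v ->
  #|[set e in star E v | [disjoint e & W]]| <= #|U|.-1 - #|W|.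
Proof.
move=> sE vU sW.
have -> : #|U|.-1 = #|U :\ v| by rewrite (cardsD1 v U) vU.
rewrite -cardsDS //.
apply: leq_trans (leq_imset_card (fun u => [set v; u]) _).
apply: subset_leq_card; apply/subsetP => e; rewrite inE => /andP[eS dj].
have [u eu uv] := pair_other sE eS.
rewrite eu; apply: imset_f; rewrite !inE uv.
have -> : u \in U.
  move: eS; rewrite inE => /andP[/(subsetP sE)]; rewrite inE => /andP[/subsetP + _] _.
  by apply; rewrite eu !inE eqxx orbT.
by rewrite (disjointFr dj) // eu !inE eqxx orbT.
Qed.

Lemma degree_lt U E v : E \subset pairs U -> v \in U -> #|star E v| <= #|U|.-1.
Proof.
move=> sE vU; rewrite -[leqRHS]subn0 -(cards0 V).
apply: leq_trans (card_star_disjoint sE vU (sub0set _)).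
apply: subset_leq_card; apply/subsetP => e eS; rewrite inE eS.
by rewrite -setI_eq0 setI0 eqxx.
Qed.

Lemma pairs_del U E v : E \subset pairs U -> E :\: star E v \subset pairs (U :\ v).
Proof.
move=> sE; apply/subsetP => e; rewrite !inE => /andP[+ eE]; rewrite eE /= => ve.
move: (subsetP sE _ eE); rewrite inE => /andP[sU ->]; rewrite andbT.
by rewrite subsetD1 sU.
Qed.

Lemma cover_sub U E k M : E \subset pairs U -> M \in matchings E k -> cover M \subset U.
Proof.
move=> sE; rewrite inE => /and3P[sM _ _]; apply/bigcupsP => e.
by move/(pairs_sub sE sM) => [].
Qed.

(** A [k]-matching avoiding [v] covers [2k] vertices and so blocks at most [2k] edges at [v]. *)
Lemma matchings_vertex_ge U E v k : E \subset pairs U ->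
  #|matchings (E :\: star E v) k.+1| +
  (#|star E v| - k.*2) * #|matchings (E :\: star E v) k| <= #|matchings E k.+1|.
Proof.
move=> sE; rewrite (matchings_vertex v k sE) leq_add2l mulnC -sum_nat_const.
apply: leq_sum => M MM.
have sE' := pairs_del v sE.
have vM : v \notin cover M.
  by apply/negP => /(subsetP (cover_sub sE' MM)); rewrite !inE eqxx.
have := card_star_meet sE vM; rewrite (card_cover_matching sE' MM).
have := cardsID [set e : {set V} | [disjoint e & cover M]] (star E v).
have -> : star E v :&: [set e : {set V} | [disjoint e & cover M]] = [set e in star E v | [disjoint e & cover M]].
  by apply/setP => e; rewrite !inE.
have -> : star E v :\: [set e : {set V} | [disjoint e & cover M]] = [set e in star E v | ~~ [disjoint e & cover M]].
  by apply/setP => e; rewrite !inE andbC.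
by move=> <- le; rewrite leq_subLR [leqRHS]addnC leq_add2l.
Qed.

(** A [k]-matching avoiding [v] leaves only [#|U| - 1 - 2k] possible partners for [v]. *)
Lemma matchings_vertex_le U E v k : E \subset pairs U -> v \in U ->
  #|matchings E k.+1| <= #|matchings (E :\: star E v) k.+1| +
  (#|U|.-1 - k.*2) * #|matchings (E :\: star E v) k|.
Proof.
move=> sE vU; rewrite (matchings_vertex v k sE) leq_add2l mulnC -sum_nat_const.
apply: leq_sum => M MM; have sE' := pairs_del v sE.
by rewrite -(card_cover_matching sE' MM); apply: card_star_disjoint => //; apply: cover_sub MM.
Qed.

End Matchings.


(** * The matching numbers of the extremal graph *)

(* The number of k-matchings of S_{n,m}, by deletion of a vertex of K_m; the
   case k = 1 counts the edges. *)
Fixpoint split_matchings (m n k : nat) : nat :=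
  match k, m with
  | 0, _ => 1
  | _.+1, 0 => 0
  | k'.+1, m'.+1 =>
      split_matchings m' n.-1 k + (n.-1 - k'.*2) * split_matchings m' n.-1 k'
  end.

Lemma split_matchings0 m n : split_matchings m n 0 = 1.
Proof. by case: m. Qed.

(** Pascal's rule matches the recursion. The bound also shows that the value is 0 for [k > m]. *)
Lemma split_matchings_le m n k : split_matchings m n k <= 'C(m, k) * n ^ k.
Proof.
elim: m n k => [|m IH] n [|k]; rewrite ?split_matchings0 ?bin0 //=.
rewrite binS mulnDl; apply: leq_add.
  apply: leq_trans (IH _ _) _; rewrite leq_mul2l leq_exp2r ?leq_pred //.
  by rewrite orbT.
rewrite expnS mulnCA leq_mul //; first lia.
apply: leq_trans (IH _ _) _; rewrite leq_mul2l; apply/orP; right.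
by case: k => // k; rewrite leq_exp2r // leq_pred.
Qed.

Lemma split_matchings1 m n : m <= n ->
  split_matchings m n 1 + 'C(n - m, 2) = 'C(n, 2).
Proof.
elim: m n => [|m IH] [|n] //= le; rewrite ?subn0 //.
by rewrite split_matchings0 muln1 subSS binS bin1 -(IH n le); lia.
Qed.

Lemma split_matchings1_ge m n : m <= n -> m * n <= split_matchings m n 1 + m ^ 2.
Proof.
elim: m n => [|m IH] [|n] //= le; have := IH n le.
rewrite split_matchings0 -!mulnn; lia.
Qed.

(** * Comparison with the extremal graph by deleting large vertices *)

Section Bounds.
Variable V : finType.
Implicit Types (E M : {set {set V}}) (e : {set V}) (v : V) (U B : {set V}).

(** The set [B] is a vertex cover. When its vertices are deleted one at a time,
    [matchings_vertex_le] follows the recursion of [split_matchings]. *)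
Lemma matchings_le_split U B E k : E \subset pairs U -> B \subset U ->
  (forall e, e \in E -> ~~ [disjoint e & B]) ->
  #|matchings E k| <= split_matchings #|B| #|U| k.
Proof.
move mB: #|B| => m; elim: m U B E k mB => [|m IH] U B E k mB sE sB meet.
  have E0 : E = set0.
    apply/setP => e; rewrite inE; apply/negP => /meet.
    by rewrite (cards0_eq mB) -setI_eq0 setI0 eqxx.
  case: k => [|k] /=; first by rewrite matchings0.
  by rewrite matchings_lt // E0 cards0.
case: k => [|k]; first by rewrite matchings0.
have [v vB] : exists v, v \in B by apply/set0Pn; rewrite -card_gt0 mB.
have vU := subsetP sB _ vB.
have {}IH k' : #|matchings (E :\: star E v) k'| <= split_matchings m #|U|.-1 k'.
  have -> : #|U|.-1 = #|U :\ v| by rewrite (cardsD1 v U) vU.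
  apply: (IH _ (B :\ v)); first by move: mB; rewrite (cardsD1 v B) vB => -[].
  - exact: pairs_del.
  - exact: setSD.
  move=> e; rewrite !inE => /andP[+ eE]; rewrite eE /= => ve.
  have := meet e eE; rewrite -!setI_eq0 => /set0Pn[x]; rewrite inE => /andP[xe xB].
  apply/set0Pn; exists x; rewrite !inE xe xB !andbT.
  by apply: contraNneq ve => <-.
apply: leq_trans (matchings_vertex_le k sE vU) _.
by rewrite /= leq_add ?IH // leq_mul2l IH orbT.
Qed.

(** The only edge that [b] can lose is [[set v; b]]. *)
Lemma degree_del U E v b : E \subset pairs U -> b != v ->
  #|star E b| <= #|star (E :\: star E v) b|.+1.
Proof.
move=> sE bv; rewrite -addn1 -(cardsID (star E v) (star E b)) addnC leq_add //.
  apply: subset_leq_card; apply/subsetP => e; rewrite !inE.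
  by case: (e \in E); case: (b \in e); case: (v \in e).
rewrite -(cards1 [set v; b]); apply: subset_leq_card; apply/subsetP => e.
rewrite inE => /andP[eb ev].
have [u eu uv] := pair_other sE ev.
move: eb; rewrite !inE eu !inE (negPf bv) /= => /andP[_ /eqP->].
by rewrite eqxx.
Qed.

(* [d] is the number of edges missing at [v]: they are surplus edges of the
   graph left after deleting [v]. *)
Lemma matchings_step U E v m p t d k :
  E \subset pairs U -> #|star E v| + d = #|U|.-1 ->
  split_matchings m.+1 #|U| 1 + t <= #|E| ->
  (forall t', split_matchings m #|U|.-1 1 + t' <= #|E :\: star E v| ->
     forall k', split_matchings m #|U|.-1 k'.+1 + t' * ('C(m, k') * p ^ k')
       <= #|matchings (E :\: star E v) k'.+1|) ->
  p + k.*2 <= #|star E v| ->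
  split_matchings m.+1 #|U| k.+1 + (t + d) * ('C(m.+1, k) * p ^ k) <=
  #|matchings E k.+1| + d * split_matchings m #|U|.-1 k.
Proof.
move=> sE dE cE IH hp; set E' := E :\: star E v.
have cE' : #|E| = #|star E v| + #|E'|.
  rewrite -(cardsID (star E v) E) (setIidPr _) //.
  by apply/subsetP => e; rewrite inE => /andP[].
(* Deleting [v] removes [#|U| - 1 - d] edges, while the reference count drops by [#|U| - 1]; hence
   the surplus grows from [t] to [t + d]. *)
have {}IH := IH (t + d).
have IH' : split_matchings m #|U|.-1 1 + (t + d) <= #|E'|.
  move: cE; rewrite cE' -/E' /= split_matchings0 muln1 subn0 -{2}dE.
  have aux F a b : F + (a + d) + t <= a + b -> F + (t + d) <= b by lia.
  exact: aux.
move: (IH IH') => {}IH.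
have ge := matchings_vertex_ge v k sE; rewrite -/E' in ge.
case: k hp ge => [|k] hp ge.
  move: (IH 0) ge; rewrite !bin0 /= !split_matchings0 matchings0 -/E'.
  rewrite !expn0 !muln1 double0 !subn0.
  move: dE; move: (split_matchings _ _ _) #|matchings _ _| #|matchings _ _|.
  by move: #|star E v| #|U|.-1 => *; lia.
move: (IH k) (IH k.+1) ge.
rewrite /= -/E' binS expnS.
set f1 := #|matchings E' k.+1|; set f2 := #|matchings E' k.+2|.
set f := #|matchings E k.+2|; set F1 := split_matchings m _ k.+1.
set F2 := split_matchings m _ k.+2; set P := p ^ k.
set c1 := 'C(m, k); set c2 := 'C(m, k.+1).
move=> i1 i2 ge.
have w : (#|star E v| - k.+1.*2) + d = #|U|.-1 - k.+1.*2 by lia.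
have wp : p <= #|star E v| - k.+1.*2 by lia.
move: ge w wp; rewrite -/E'; set a := #|star E v| - k.+1.*2; set b := #|U|.-1 - _.
move=> ge w wp.
have h1 : a * (F1 + (t + d) * (c1 * P)) <= a * f1 by rewrite leq_mul2l i1 orbT.
have h2 : p * ((t + d) * (c1 * P)) <= a * ((t + d) * (c1 * P)) by rewrite leq_mul2r wp orbT.
(* Pascal's rule splits the credit of the surplus edges: the [c2] part comes from matchings avoiding
   [v], the [c1] part from those through [v], where at least [p] edges at [v] remain available. *)
have e : (t + d) * ((c2 + c1) * (p * P)) =
  (t + d) * (c2 * (p * P)) + p * ((t + d) * (c1 * P)) by lia.
rewrite e -w mulnDl; move: h1 h2 i2 ge; rewrite mulnDr.
move: ((t + d) * (c1 * P)) ((t + d) * _) => X Y.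
move: (a * X) (a * F1) (a * f1) (p * X) (d * F1) => *.
lia.
Qed.

Variables (n0 M p : nat).
(* An extra edge is worth more than an edge missing at a large vertex; [p] is
   slightly smaller than [n0]. *)
Hypothesis binom_gap : forall m j, 0 < j <= m.+1 -> m < M ->
  'C(m, j) * n0 ^ j < 'C(m.+1, j) * p ^ j.

Lemma split_matchings_gap m n k : 0 < k <= m.+1 -> m < M -> n <= n0 ->
  split_matchings m n k < 'C(m.+1, k) * p ^ k.
Proof.
move=> km mM nn; apply: leq_ltn_trans (binom_gap km mM).
apply: leq_trans (split_matchings_le _ _ _) _.
by rewrite leq_mul2l leq_exp2r ?nn ?orbT //; case/andP: km.
Qed.

(** Induction on [#|B|]. A deletion lowers [#|U|] by one and each remaining degree by at most one,
    so the same [T] serves throughout. The hypothesis on [p + T] leaves [p] usable edges at the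
    deleted vertex. *)
Lemma card_matchings_ge T U B E t k :
  E \subset pairs U -> B \subset U -> #|B| <= M -> #|U| <= n0 ->
  (forall b, b \in B -> #|U| <= #|star E b| + T.+1) ->
  p + T + (#|B|.*2).+1 <= #|U| ->
  split_matchings #|B| #|U| 1 + t <= #|E| ->
  split_matchings #|B| #|U| k.+1 + t * ('C(#|B|, k) * p ^ k) <= #|matchings E k.+1|.
Proof.
move mB: #|B| => m; elim: m U B E t k mB => [|m IH] U B E t k mB sE sB mM nn deg hp cE.
  case: k => [|k] /=; rewrite ?bin0 ?bin_small ?mul0n ?muln0 //.
  by rewrite matchings1E card_imset ?muln1 //; apply: set1_inj.
have [v vB] : exists v, v \in B by apply/set0Pn; rewrite -card_gt0 mB.
have vU := subsetP sB _ vB.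
have cU : #|U|.-1 = #|U :\ v| by rewrite (cardsD1 v U) vU.
case: (ltnP m.+1 k) => km.
  rewrite bin_small // mul0n muln0 addn0.
  apply: leq_trans (split_matchings_le _ _ _) _.
  by rewrite bin_small // ltnW.
have hstep : p + k.*2 <= #|star E v| by move: (deg _ vB) hp; lia.
have [d dE] : exists d, #|star E v| + d = #|U|.-1.
  by exists (#|U|.-1 - #|star E v|); rewrite subnKC // (degree_lt sE).
have step := matchings_step sE dE cE _ hstep.
have {}step : split_matchings m.+1 #|U| k.+1 + (t + d) * ('C(m.+1, k) * p ^ k) <=
  #|matchings E k.+1| + d * split_matchings m #|U|.-1 k.
  apply: step => t' ct' k'; rewrite cU.
  apply: (IH _ (B :\ v)).
  - by move: mB; rewrite (cardsD1 v B) vB => -[].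
  - exact: pairs_del.
  - exact: setSD.
  - exact: ltnW.
  - by apply: leq_trans nn; rewrite -cU leq_pred.
  - move=> b; rewrite !inE => /andP[bv bB].
    have := deg b bB; rewrite -cU.
    have := degree_del sE bv; lia.
  - by rewrite -cU; move: hp; lia.
  - by rewrite -cU.
(* The credit for the [d] surplus edges covers the loss from the [d] missing ones. For [k = 0] the
   two are equal. *)
have : d * split_matchings m #|U|.-1 k <= d * ('C(m.+1, k) * p ^ k).
  rewrite leq_mul2l; apply/orP; right.
  case: (posnP k) => [->|k0]; first by rewrite split_matchings0 bin0 expn0.
  apply: ltnW; apply: split_matchings_gap; rewrite ?k0 //.
  exact: leq_trans (leq_pred _) nn.
move: step; rewrite mulnDl /=; move: (t * _) (d * _) (d * _) (_ + _ * _) => X Y Z W.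
move: #|_| => f; lia.
Qed.

(** The vertex with a missing edge is deleted first. Then [d > 0], and for [k > 0] the credit
    strictly exceeds the loss. *)
Lemma card_matchings_gt T U B E k :
  E \subset pairs U -> B \subset U -> #|B| <= M -> #|U| <= n0 ->
  (forall b, b \in B -> #|U| <= #|star E b| + T.+1) ->
  p + T + (#|B|.*2).+1 <= #|U| ->
  split_matchings #|B| #|U| 1 <= #|E| ->
  0 < k <= #|B| ->
  (exists2 b, b \in B & #|star E b| < #|U|.-1) ->
  split_matchings #|B| #|U| k.+1 < #|matchings E k.+1|.
Proof.
move mB: #|B| => m; case: m mB => [|m] mB sE sB mM nn deg hp cE km [v vB dv].
  by move: vB; rewrite (cards0_eq mB) inE.
have vU := subsetP sB _ vB.
have cU : #|U|.-1 = #|U :\ v| by rewrite (cardsD1 v U) vU.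
have hstep : p + k.*2 <= #|star E v| by move: (deg _ vB) hp; lia.
have cE0 : split_matchings m.+1 #|U| 1 + 0 <= #|E| by rewrite addn0.
have [d dE] : exists d, #|star E v| + d = #|U|.-1.
  by exists (#|U|.-1 - #|star E v|); rewrite subnKC // (degree_lt sE).
have step := matchings_step sE dE cE0 _ hstep.
have {}step : split_matchings m.+1 #|U| k.+1 + (0 + d) * ('C(m.+1, k) * p ^ k) <=
  #|matchings E k.+1| + d * split_matchings m #|U|.-1 k.
  apply: step => t' ct' k'; rewrite cU.
  have mB' : #|B :\ v| = m by move: mB; rewrite (cardsD1 v B) vB => -[].
  rewrite -mB'; apply: (@card_matchings_ge T).
  - exact: pairs_del.
  - exact: setSD.
  - by rewrite mB' ltnW.
  - by apply: leq_trans nn; rewrite -cU leq_pred.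
  - move=> b; rewrite !inE => /andP[bv bB].
    have := deg b bB; rewrite -cU.
    have := degree_del sE bv; lia.
  - by rewrite mB' -cU; move: hp; lia.
  - by rewrite mB' -cU.
have : d * split_matchings m #|U|.-1 k < d * ('C(m.+1, k) * p ^ k).
  rewrite ltn_mul2l; apply/andP; split; first by move: dE; lia.
  apply: split_matchings_gap => //.
  exact: leq_trans (leq_pred _) nn.
move: step; rewrite add0n.
move: (d * _) (d * _) (split_matchings m.+1 _ _) => X Y F;
move: #|matchings E _| => f; lia.
Qed.

End Bounds.


(** * Power estimates *)

(** This is Bernoulli's inequality for [1 - g/n], with denominators cleared. *)
Lemma expn_sub_bernoulli n g q : g <= n -> n ^ q.+1 <= n * (n - g) ^ q + q * g * n ^ q.
Proof.
move=> gn; elim: q => [|q IH]; first by rewrite !expn0 expn1 mul0n muln1 addn0.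
have h : (n - g) * n ^ q.+1 <= (n - g) * (n * (n - g) ^ q + q * g * n ^ q) by rewrite leq_mul2l IH orbT.
have h2 : (n - g) * (q * g * n ^ q) <= n * (q * g * n ^ q) by rewrite leq_mul2r leq_subr orbT.
have h3 : n ^ q.+2 = (n - g) * n ^ q.+1 + g * n ^ q.+1 by rewrite -mulnDl subnK // -expnS.
have h4 : n * (q * g * n ^ q) = q * g * n ^ q.+1 by rewrite mulnCA -expnS.
have h5 : n * (n - g) ^ q.+1 = (n - g) * (n * (n - g) ^ q) by rewrite expnS mulnCA.
move: h; rewrite mulnDr h3 h5 !mulSn mulnDl; rewrite h4 in h2; lia.
Qed.

(** By Bernoulli, replacing [n] by [n - g] in [q] factors costs at most a fraction [q g / n]. On
    each of the two terms of the lower bound for [A] this is at most a sixth of the second term, so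
    the leading term survives strictly. *)
Lemma leq_expn_gain n m g q A : 0 < g -> 1 < m -> q <= m -> 6 * m * g <= n ->
  m * m.-1 * n ^ 2 + 6 * m ^ 3 * g * n <= A ->
  m * m.-1 * n ^ q.+2 < A * (n - g) ^ q.
Proof.
move=> g0 m1 qm mgn hA.
have n0 : 0 < n by apply: leq_trans mgn; rewrite !muln_gt0 g0 /=; lia.
have gn : g <= n by apply: leq_trans mgn; rewrite leq_pmull //; lia.
have B := expn_sub_bernoulli q gn.
rewrite -(ltn_pmul2l n0).
have h1 : (m * m.-1 * n ^ 2 + 6 * m ^ 3 * g * n) * (n * (n - g) ^ q) <= n * (A * (n - g) ^ q).
  by rewrite mulnCA leq_mul2l leq_mul2r hA !orbT.
apply: leq_trans h1.
set P := n * (n - g) ^ q in B *.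
have nq0 : 0 < n ^ q by rewrite expn_gt0 n0.
have e : n ^ q.+1 = n * n ^ q by rewrite expnS.
have e2 : n ^ q.+2 = n * (n * n ^ q) by rewrite !expnS.
rewrite e in B; rewrite e2; move: (n ^ q) nq0 B => Q Q0 B.
have qg : 6 * q * g <= n by apply: leq_trans mgn; rewrite leq_mul2r leq_mul2l qm !orbT.
set c := m * m.-1; set d := 6 * m ^ 3 * g.
have cq : c * q <= m ^ 3.
  rewrite /c !expnS expn0 muln1 mulnA; apply: leq_mul => //; by rewrite leq_mul2l leq_pred orbT.
have cd : 6 * (c * q * g) <= d by rewrite /d -(mulnA 6) leq_mul2l leq_mul2r cq !orbT.
have d0 : 0 < d by rewrite /d !muln_gt0 g0 /=; lia.
have k1 : (c * n ^ 2 + d * n) * (n * Q) <= (c * n ^ 2 + d * n) * (P + q * g * Q) by rewrite leq_mul2l B orbT.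
have k2 : (c * n ^ 2 + d * n) * (q * g * Q) < d * n * (n * Q).
  have -> : (c * n ^ 2 + d * n) * (q * g * Q) = (c * q * g * n + d * (q * g)) * (n * Q).
    by rewrite expnS expn1; lia.
  rewrite ltn_pmul2r ?muln_gt0 ?n0 ?Q0 //.
  have a1 : 6 * (c * q * g * n) <= d * n by rewrite mulnA leq_mul2r cd orbT.
  have a2 : 6 * (d * (q * g)) <= d * n by rewrite mulnCA leq_mul2l; apply/orP; right; move: qg; rewrite mulnA.
  have a3 : 0 < d * n by rewrite muln_gt0 d0.
  by move: (d * n) (c * q * g * n) (d * (q * g)) a1 a2 a3; lia.
move: k1 k2; rewrite mulnDr mulnDl => k1 k2.
have -> : n * (c * (n * (n * Q))) = c * n ^ 2 * (n * Q) by rewrite expnS expn1; lia.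
by move: (c * n ^ 2 * (n * Q)) (d * n * (n * Q)) (_ * P) (_ * (q * g * Q)) k1 k2 => *; lia.
Qed.

(** * Greedy counting of matchings and the surplus it yields *)

Section Greedy.
Variable V : finType.
Implicit Types (E M : {set {set V}}) (e : {set V}) (v : V) (U B : {set V}).

(** Double counting: adding an edge to a [k]-matching gives a [k.+1]-matching with one marked edge,
    and there are [k.+1] ways to mark. *)
Lemma matchings_extend U E k : E \subset pairs U ->
  \sum_(M in matchings E k) #|[set e in E | [disjoint e & cover M]]|
    <= k.+1 * #|matchings E k.+1|.
Proof.
move=> sE.
pose D := [set p : {set {set V}} * {set V} |
   (p.1 \in matchings E k) && (p.2 \in [set e in E | [disjoint e & cover p.1]])].
pose D' := [set p : {set {set V}} * {set V} |
   (p.1 \in matchings E k.+1) && (p.2 \in p.1)].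
have -> : \sum_(M in matchings E k) #|[set e in E | [disjoint e & cover M]]| = #|D|.
  rewrite -sum1_card (eq_bigr (fun M => \sum_(e in [set e in E | [disjoint e & cover M]]) 1)).
    by rewrite pair_big_dep /=; apply: eq_bigl => p; rewrite [in RHS]inE.
  by move=> M _; rewrite sum1_card.
have <- : #|D'| = k.+1 * #|matchings E k.+1|.
  rewrite mulnC -sum_nat_const -sum1_card (eq_bigr (fun M : {set {set V}} => \sum_(e in M) 1)).
    by rewrite pair_big_dep /=; apply: eq_bigl => p; rewrite inE.
  by move=> M; rewrite inE => /and3P[_ _ /eqP]; rewrite sum1_card.
have DP M e : (M, e) \in D -> [/\ M \in matchings E k, e \in E, trivIset (e |: M) & e \notin M].
  rewrite inE /= => /andP[MM]; rewrite inE => /andP[eE dM].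
  have e0 : #|e| != 0 by have [_ ->] := pairs_sub sE (subxx E) eE.
  have tM : trivIset M by move: MM; rewrite inE => /and3P[].
  by have [] := trivIsetU1 e0 tM dM.
rewrite -(card_in_imset (f := fun p : {set {set V}} * {set V} => (p.2 |: p.1, p.2)) (D := D)).
  apply: subset_leq_card; apply/subsetP => _ /imsetP[[M e] /DP[+ eE tM nM] ->].
  rewrite !inE /= eqxx andbT => /and3P[sM _ /eqP cM].
  by rewrite tM cardsU1 nM cM eqxx subUset sub1set eE sM.
move=> [M1 e1] [M2 e2] /DP[_ _ _ n1] /DP[_ _ _ n2] /= [E12 e12].
by rewrite -(setU1K n1) -(setU1K n2) E12 e12.
Qed.

(** Each of the [k] edges already chosen blocks at most [D] edges, itself included. *)
Lemma matchings_greedy U E k D : E \subset pairs U ->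
  (forall e, e \in E -> #|[set e' in E | ~~ [disjoint e' & e]]| <= D) ->
  #|matchings E k| * (#|E| - k * D) <= k.+1 * #|matchings E k.+1|.
Proof.
move=> sE conf; apply: leq_trans (matchings_extend k sE).
rewrite -sum_nat_const; apply: leq_sum => M; rewrite inE => /and3P[sM _ /eqP cM].
pose W := \bigcup_(e in M) [set e' in E | ~~ [disjoint e' & e]].
have cW : #|W| <= k * D.
  rewrite -cM -sum_nat_const /W.
  elim/big_rec2: _ => [|e A B eM le]; first by rewrite cards0.
  by apply: leq_trans (leq_card_setU _ _) _; rewrite leq_add // conf // (subsetP sM).
rewrite leq_subLR; apply: leq_trans (leq_add cW (leqnn _)).
apply: leq_trans (leq_card_setU _ _); apply: subset_leq_card.
apply/subsetP => e eE; rewrite !inE eE /=.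
case: (boolP [disjoint e & cover M]) => [|dj]; first by rewrite orbT.
move: dj; rewrite -setI_eq0 => /set0Pn[x]; rewrite inE => /andP[xe /bigcupP[e' e'M xe']].
apply/orP; left; apply/bigcupP; exists e' => //; rewrite inE eE -setI_eq0.
by apply/set0Pn; exists x; rewrite inE xe.
Qed.

Lemma matchings2_ge U E : E \subset pairs U ->
  \sum_(e in E) #|[set e' in E | [disjoint e' & e]]| <= 2 * #|matchings E 2|.
Proof.
move=> sE; apply: leq_trans (matchings_extend 1 sE).
rewrite matchings1E big_imset /=; last by move=> e1 e2 _ _; apply: set1_inj.
by apply: leq_sum => e _; rewrite cover1.
Qed.

Lemma card_conflicts U E e : E \subset pairs U -> e \in E ->
  #|[set e' in E | ~~ [disjoint e' & e]]| <= \sum_(v in e) #|star E v|.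
Proof.
move=> sE eE.
have : [set e' in E | ~~ [disjoint e' & e]] \subset \bigcup_(v in e) star E v.
  apply/subsetP => e'; rewrite inE => /andP[e'E].
  rewrite -setI_eq0 => /set0Pn[x]; rewrite inE => /andP[xe' xe].
  by apply/bigcupP; exists x => //; rewrite inE e'E.
move/subset_leq_card/leq_trans; apply.
elim/big_rec2: _ => [|v A B _ le]; first by rewrite cards0.
by apply: leq_trans (leq_card_setU _ _) _; rewrite leq_add.
Qed.

Lemma sum_degrees U E : E \subset pairs U -> \sum_v #|star E v| = 2 * #|E|.
Proof.
move=> sE; rewrite mulnC -sum_nat_const.
rewrite [RHS](eq_bigr (fun e : {set V} => \sum_(v in e) 1)); last first.
  by move=> e eE; rewrite sum1_card; have [_ ->] := pairs_sub sE (subxx E) eE.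
rewrite (exchange_big_dep predT) //=; apply: eq_bigr => v _.
by rewrite -sum1_card; apply: eq_bigl => e; rewrite inE.
Qed.

(* [h] is the degree from which a vertex is large.  Edges joining two large
   vertices are few and are thrown away; each remaining edge meets at most
   n + h others, and at most n + h - T if it avoids the vertices of degree at
   least n - T - 1, where T = 16 m^3 g. *)
Lemma many_large_degrees E n m k h g :
  E \subset pairs [set: V] -> #|V| = n -> 1 < k <= m -> 0 < g -> 6 * m * g <= n ->
  m * n <= #|E| + m ^ 2 -> #|E| <= m * n ->
  (forall q, q * h <= 2 * (m * n) -> m ^ 2 + q ^ 2 + m * h <= g) ->
  'C(m, k) * n ^ k < #|matchings E k| \/
  m <= #|[set v | n <= #|star E v| + (16 * m ^ 3 * g).+1]|.
Proof.
move=> sE cV /andP[k1 km] g0 gn cE1 cE2 hg; set T := 16 * _ * _.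
set H := [set v | _]; case: (leqP m #|H|) => [|mH]; [by right|left].
have m1 : 1 < m by apply: leq_trans km.
(* By the degree sum [L] is small, so discarding the edges inside [L] costs at most [#|L| ^ 2],
   which [g] absorbs. *)
pose L := [set v | h <= #|star E v|].
have hL : #|L| * h <= 2 * (m * n).
  apply: leq_trans (_ : 2 * #|E| <= _); last by rewrite leq_mul2l cE2 orbT.
  rewrite -(sum_degrees sE) -sum_nat_const [leqRHS](bigID (mem L)) /=.
  by apply: leq_trans (leq_addr _ _); apply: leq_sum => v; rewrite inE.
have {}hg := hg _ hL.
pose E1 := [set e in E | ~~ (e \subset L)].
have sE1 : E1 \subset E by apply/subsetP => e; rewrite inE => /andP[].
have sE1p := subset_trans sE1 sE.
have cE : #|E| <= #|E1| + #|L| ^ 2.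
  rewrite -(cardsID [set e : {set V} | ~~ (e \subset L)] E) leq_add //.
    by apply: subset_leq_card; apply/subsetP => e; rewrite !inE.
  have -> : #|L| ^ 2 = #|setX L L| by rewrite cardsX.
  apply: leq_trans (leq_imset_card (fun p : V * V => [set p.1; p.2]) _).
  apply: subset_leq_card; apply/subsetP => e; rewrite !inE negbK => /andP[eL eE].
  have [_ /eqP/cards2P[x [y [xy exy]]]] := pairs_sub sE (subxx _) eE.
  apply/imsetP; exists (x, y) => //=; rewrite inE /=.
  by rewrite !(subsetP eL) // exy !inE eqxx ?orbT.
have n0 : 0 < n by apply: leq_trans gn; rewrite !muln_gt0 g0 /=; lia.
have degn v : #|star E v| < n.
  by have := degree_lt sE (in_setT v); rewrite cardsT cV; lia.
(* An edge of [E1] has an endpoint of degree below [h]. If it also avoids [H], its other endpoint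
   has degree below [n - T - 1], which saves [T] conflicts. *)
pose good := [set e in E1 | [disjoint e & H]].
have sdeg e : e \in E1 -> \sum_(v in e) #|star E v| + T * (e \in good) <= n + h.
  move=> eE1; have := eE1; rewrite [_ \in E1]inE => /andP[eE eL].
  have [_ /eqP/cards2P[x [y [xy exy]]]] := pairs_sub sE (subxx _) eE.
  have -> : (e \in good) = [disjoint e & H] by rewrite inE eE1.
  rewrite exy big_setU1 ?inE //= big_set1.
  case: (boolP [disjoint _ & H]) => [dH|_]; last first.
    rewrite muln0 addn0; move: eL; rewrite exy subUset !sub1set !inE.
    by move: (degn x) (degn y); move: #|star E x| #|star E y| => a b; lia.
  have xH : x \notin H by rewrite (disjointFr dH) // !inE eqxx.
  have yH : y \notin H by rewrite (disjointFr dH) // !inE eqxx orbT.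
  move: eL; rewrite exy subUset !sub1set !inE.
  move: xH yH; rewrite !inE muln1 -/T; move: #|star E x| #|star E y| (T) => a b t; lia.
have conf e : e \in E1 ->
    #|[set e' in E1 | ~~ [disjoint e' & e]]| + T * (e \in good) <= n + h.
  move=> eE1; apply: leq_trans (sdeg e eE1); rewrite leq_add2r.
  apply: leq_trans (card_conflicts sE1p eE1) _; apply: leq_sum => v _.
  apply: subset_leq_card; apply/subsetP => e'; rewrite !inE => /andP[/andP[-> _] ->].
  by [].
(* Fewer than [m] vertices lie in [H], and they meet at most [m.-1 * n] edges; so about [n] edges at
   least are good. *)
have cgood : #|E1| <= #|good| + m.-1 * n.
  rewrite -(cardsID [set e : {set V} | [disjoint e & H]] E1) leq_add //.
    by apply: subset_leq_card; apply/subsetP => e; rewrite !inE.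
  apply: leq_trans (_ : #|H| * n <= _); last by rewrite leq_mul2r; lia.
  apply: leq_trans (_ : #|\bigcup_(v in H) star E v| <= _).
    apply: subset_leq_card; apply/subsetP => e; rewrite !inE => /and3P[dj eE eL].
    move: dj; rewrite -setI_eq0 => /set0Pn[x]; rewrite inE => /andP[xe xH].
    by apply/bigcupP; exists x => //; rewrite inE eE.
  rewrite -sum_nat_const; elim/big_rec2: _ => [|v a A _ le]; first by rewrite cards0.
  by apply: leq_trans (leq_card_setU _ _) _; rewrite leq_add // ltnW.
(* Ordered pairs of edges of [E1] are counted: disjoint pairs give each 2-matching twice, and each
   edge has at most [n + h] conflicts, or [T] fewer if it is good. *)
have two : #|E1| * #|E1| + T * #|good| <= 2 * #|matchings E1 2| + #|E1| * (n + h).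
  have -> : T * #|good| = \sum_(e in E1) T * (e \in good).
    rewrite -big_distrr /=; congr (_ * _); rewrite -sum1_card big_mkcond /=.
    rewrite [RHS]big_mkcond /=; apply: eq_bigr => e _; rewrite inE.
    by case: (e \in E1); case: [disjoint e & H].
  apply: leq_trans (leq_add (matchings2_ge sE1p) (leqnn _)).
  rewrite -!sum_nat_const -!big_split /=; apply: leq_sum => e eE1.
  rewrite -[in X in X <= _](cardsID [set e' : {set V} | [disjoint e' & e]] E1) -addnA.
  apply: leq_add.
    by apply: subset_leq_card; apply/subsetP => e'; rewrite !inE.
  apply: leq_trans (conf e eE1); rewrite leq_add2r.
  by apply: subset_leq_card; apply/subsetP => e'; rewrite !inE andbC.
have base : m * n + m * h <= #|E1| + g.
  move: cE cE1 hg; move: (m * n) (m * h) (m ^ 2) (#|L| ^ 2) => *; lia.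
have gn2 : 2 * g <= n by apply: leq_trans gn; rewrite leq_mul2r; apply/orP; right; lia.
have gn' : g <= n by lia.
(* At least [n / 2] edges are good, so the 16 in [T] yields [8 * m ^ 3 * g * n]; the error
   [2 * g * m * n] in the main product takes away at most [2 * m ^ 3 * g * n], leaving the factor
   6. *)
have gain : m * m.-1 * n ^ 2 + 6 * m ^ 3 * g * n <= 2 * #|matchings E1 2|.
  have hm : h <= m * h by rewrite leq_pmull // ltnW.
  have mn : m * n = n + m.-1 * n by rewrite -mulSn prednK // ltnW.
  have [a N1a] : exists a, #|E1| = a + (n + h).
    have le : n <= m.-1 * n by rewrite leq_pmull //; lia.
    exists (#|E1| - (n + h)); rewrite subnK //; lia.
  have cE1' : #|E1| <= m * n := leq_trans (subset_leq_card sE1) cE2.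
  have hgood : 8 * m ^ 3 * g * n <= T * #|good|.
    have : 2 * g <= n -> n <= 2 * #|good| by lia.
    move=> /(_ gn2) hh; rewrite /T.
    apply: leq_trans (_ : 8 * m ^ 3 * g * (2 * #|good|) <= _); first by rewrite leq_mul2l hh orbT.
    by apply: eq_leq; lia.
  have prod : (m * n) * (m.-1 * n) <= (#|E1| + g) * (a + g) by apply: leq_mul; lia.
  have prod2 : g * (#|E1| + a + g) <= g * (2 * (m * n)) by rewrite leq_mul2l; apply/orP; right; lia.
  have mm : 2 * (g * (m * n)) <= 2 * m ^ 3 * g * n.
    have -> : 2 * m ^ 3 * g * n = 2 * m ^ 3 * (g * n) by lia.
    have -> : 2 * (g * (m * n)) = 2 * m * (g * n) by lia.
    rewrite leq_mul2r leq_mul2l -{1}(expn1 m) leq_exp2l ?orbT //.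
  have e1 : m * m.-1 * n ^ 2 = (m * n) * (m.-1 * n) by rewrite expnS expn1; lia.
  have e2 : (#|E1| + g) * (a + g) = #|E1| * a + g * (#|E1| + a + g) by lia.
  have two' : #|E1| * a + T * #|good| <= 2 * #|matchings E1 2|.
    by move: two; rewrite {2}N1a mulnDr; move: (_ * a) (_ * (n + h)) (_ * #|good|) => *; lia.
  have y c : c * m ^ 3 * g * n = c * (m ^ 3 * g * n) by lia.
  have e3 : g * (2 * (m * n)) = 2 * (g * (m * n)) by lia.
  move: prod prod2 mm hgood two'; rewrite e1 e2 e3 !y.
  move: (m ^ 3 * _ * _) (T * _) (#|E1| * a) (g * (_ + _)) (m * n * _) (g * (m * n)) => *; lia.
(* The surplus is gained at the 2-matchings only; the further edges are added greedily, each step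
   losing just the passage from [n] to [n - g]. *)
have greedy q : q.+2 <= m ->
    2 * #|matchings E1 2| * (m - 2) ^_ q * (n - g) ^ q <= q.+2`! * #|matchings E1 q.+2|.
  elim: q => [|q IH] qm; first by rewrite ffactn0 expn0 !muln1.
  have := @matchings_greedy _ E1 q.+2 (n + h) sE1p _.
  have conf' e : e \in E1 -> #|[set e' in E1 | ~~ [disjoint e' & e]]| <= n + h.
    by move=> eE1; apply: leq_trans (conf e eE1); rewrite leq_addr.
  move/(_ conf') => gr.
  have big : (m - 2 - q) * (n - g) <= #|E1| - q.+2 * (n + h).
    have [r mr] : exists r, m = r.+1 + q.+2 by exists (m - q.+3); lia.
    have -> : m - 2 - q = r.+1 by lia.
    have : r.+1 * (n - g) + g <= r.+1 * n.
      by rewrite -{2}(subnK gn') mulnDr leq_add2l leq_pmull.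
    have : q.+2 * h <= m * h by rewrite leq_mul2r mr leq_addl orbT.
    have mn : m * n = r.+1 * n + q.+2 * n by rewrite mr mulnDl.
    move: base; rewrite mn mulnDr.
    move: (_ * (n - g)) (_ * n) (_ * n) (q.+2 * h) (m * h) => *; lia.
  rewrite ffactnSr expnSr factS.
  have {}IH := leq_mul (IH (ltnW qm)) big.
  have {}gr : q.+2`! * (#|matchings E1 q.+2| * (#|E1| - q.+2 * (n + h))) <= q.+2`! * (q.+3 * #|matchings E1 q.+3|) by rewrite leq_mul2l gr orbT.
  move: IH gr; move: (2 * _) (_ ^_ q) (m - 2 - q) (n - g) ((n - g) ^ q) (q.+2)`! => a b d e c f.
  move: #|matchings E1 q.+2| (#|E1| - _) #|matchings E1 q.+3| => x y z IH gr.
  have -> : a * (b * d) * (c * e) = a * b * c * (d * e) by lia.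
  by apply: leq_trans IH _; move: gr; rewrite mulnA [f * (_ * _)]mulnCA mulnA.
apply: leq_trans (matchings_sub k sE1).
have [q kq] : exists q, k = q.+2 by exists (k - 2); lia.
(* After multiplication by [k!] the binomial becomes [m * m.-1 * (m - 2) ^_ q], in the shape of
   [greedy] and [leq_expn_gain]. *)
rewrite kq in km *; rewrite -(ltn_pmul2r (fact_gt0 q.+2)) mulnAC bin_ffact mulnC [leqRHS]mulnC.
apply: leq_trans (greedy q km).
have qm : q <= m by lia.
have := leq_expn_gain g0 m1 qm gn gain.
rewrite ffactnS; have -> : m.-1 ^_ q.+1 = m.-1 * (m - 2) ^_ q by rewrite ffactnS; congr (_ * (_ ^_ _)); lia.
have f0 : 0 < (m - 2) ^_ q by rewrite ffact_gt0; lia.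
rewrite -(ltn_pmul2r f0) => lt; apply: leq_trans (_ : _ <= 2 * #|matchings E1 2| * (n - g) ^ q * (m - 2) ^_ q) _.
  by apply: leq_trans lt; rewrite ltnS; apply: eq_leq; lia.
by apply: eq_leq; lia.
Qed.

End Greedy.


(** * The set-pair inequality of Bollobas *)

Section Bollobas.
Import Order.TTheory GRing.Theory Num.Theory.
Local Open Scope ring_scope.

Definition bollobas_weight (a b : nat) : rat := 'C(a + b, a)%:R^-1.

Lemma bollobas_weight_pred a b : (0 < b)%N ->
  b%:R * bollobas_weight a b.-1 = (a + b)%:R * bollobas_weight a b.
Proof.
case: b => // b _; rewrite /bollobas_weight /=.
have c1 : 'C(a + b.+1, a)%:R != 0 :> rat by rewrite pnatr_eq0 -lt0n bin_gt0 leq_addr.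
have c0 : 'C(a + b, a)%:R != 0 :> rat by rewrite pnatr_eq0 -lt0n bin_gt0 leq_addr.
apply: (mulIf c1); rewrite mulfVK // mulrAC; apply: (mulIf c0); rewrite mulfVK //.
rewrite -!natrM; congr _%:R.
by have := mul_bin_down (a + b.+1) a; rewrite addnS /= subSn ?leq_addr // addKn => ->.
Qed.

(** With [a = #|A|] and [b = #|B|], the [b] points of [B] contribute [a + b] times the weight by
    [bollobas_weight_pred], and the [#|U| - a - b] points outside both sets contribute it once
    each. *)
Lemma bollobas_weight_sum (T : finType) (U A B : {set T}) :
  A \subset U -> B \subset U -> [disjoint A & B] -> B != set0 ->
  \sum_(x in U | x \notin A) bollobas_weight #|A| #|B :\ x| =
  #|U|%:R * bollobas_weight #|A| #|B|.
Proof.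
move=> sA sB dAB B0; rewrite (bigID (mem B)) /=.
rewrite (eq_bigl (mem B)); last first.
  move=> x /=; case: (boolP (x \in B)) => xB; rewrite ?andbF ?andbT //.
  by rewrite (subsetP sB) // (disjointFl dAB).
rewrite (eq_bigr (fun=> bollobas_weight #|A| #|B|.-1)); last first.
  by move=> x xB; rewrite (cardsD1 x B) (_ : x \in B).
rewrite [X in _ + X](eq_bigl (mem (U :\: (A :|: B)))); last first.
  by move=> x; rewrite !inE; case: (x \in U); case: (x \in A); case: (x \in B).
rewrite [X in _ + X](eq_bigr (fun=> bollobas_weight #|A| #|B|)); last first.
  move=> x /setDP[_]; rewrite inE negb_or => /andP[_ xB].
  by rewrite (cardsD1 x B) (negPf xB).
rewrite !sumr_const -[X in X + _]mulr_natl -[X in _ + X]mulr_natl.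
rewrite bollobas_weight_pred ?card_gt0 // -mulrDl -natrD; congr (_%:R * _).
have cAB : #|A :|: B| = (#|A| + #|B|)%N.
  by rewrite cardsU (disjoint_setI0 dAB) cards0 subn0.
rewrite -cAB cardsDS ?subUset ?sA //= subnKC //.
by rewrite subset_leq_card // subUset sA.
Qed.

(* Induction on [U]: average the inequality over the families obtained by
   deleting a point [x] of [U], keeping only the [A i] that avoid [x]. *)
Lemma bollobas (T I : finType) (A B : I -> {set T}) (U : {set T}) (P : {set I}) :
  (forall i, i \in P -> [/\ A i \subset U, B i \subset U & [disjoint A i & B i]]) ->
  {in P &, forall i j, i != j -> ~~ [disjoint A i & B j]} ->
  \sum_(i in P) bollobas_weight #|A i| #|B i| <= 1.
Proof.
move cU: #|U| => n; elim: n U P B cU => [|n IH] U P B cU sub meet.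
all: have [->|/set0Pn[i0 i0P]] := eqVneq P set0; first by rewrite big_set0.
(* An empty [B i] meets no [A j], so [i] is then the only index and its weight is 1. Otherwise all
   [B i] are nonempty, as the averaging requires. *)
all: case: (pickP (fun i => (i \in P) && (B i == set0))) => [i /andP[iP /eqP Bi]|B0].
1,3: have -> : P = [set i] by
  apply/setP => j; rewrite inE; apply/idP/eqP => [jP|->//];
  apply/eqP; apply: contraTT isT => ji; have := meet _ _ jP iP ji;
  rewrite Bi -setI_eq0 setI0 eqxx.
1,2: by rewrite big_set1 /bollobas_weight Bi cards0 addn0 binn invr1.
  have := sub _ i0P; rewrite (cards0_eq cU) subset0 => -[_ /[!subset0] Bi _].
  by have := B0 i0; rewrite i0P Bi.
have n0 : 0 < #|U|%:R :> rat by rewrite cU ltr0n.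
rewrite -(ler_pM2l n0) mulr1 big_distrr /=.
rewrite (eq_bigr (fun i => \sum_(x in U | x \notin A i) bollobas_weight #|A i| #|B i :\ x|)); last first.
  move=> i iP; have [sA sB dAB] := sub i iP; rewrite bollobas_weight_sum //.
  by have := B0 i; rewrite iP /= => ->.
rewrite (exchange_big_dep (mem U)) /=; last by move=> i x _ /andP[].
rewrite -sum1_card natr_sum; apply: ler_sum => x xU.
rewrite (eq_bigl (mem [set i in P | x \notin A i])); last by move=> i; rewrite !inE xU.
apply: (IH (U :\ x)).
- by apply/eqP; rewrite -eqSS -cU (cardsD1 x U) xU.
- move=> i; rewrite inE => /andP[iP xA]; have [sA sB dAB] := sub i iP.
  rewrite subsetD1 sA xA setSD //; split=> //.
  by apply: disjointWr dAB; apply: subD1set.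
- move=> i j; rewrite !inE => /andP[iP xA] /andP[jP _] ij.
  have := meet _ _ iP jP ij; rewrite -!setI_eq0 => /set0Pn[y].
  rewrite inE => /andP[yA yB]; apply/set0Pn; exists y; rewrite !inE yA yB andbT.
  by apply: contraNneq xA => <-.
Qed.

End Bollobas.

(** * The edge bound for saturated graphs *)

Lemma card_pairs (V : finType) (U : {set V}) : #|pairs U| = 'C(#|U|, 2).
Proof. by rewrite -cards_draws; apply: eq_card => e; rewrite !inE. Qed.

(** For distinct non-edges [i] and [j], the set [K] chosen for [j] cannot contain [i], since its
    pairs other than [j] are edges. So the pairs [(i, ~: K i)] satisfy the set-pair condition, all
    with weight [1 / 'C(#|V| - m, 2)]. *)
Lemma saturated_card_edges (V : finType) (E : {set {set V}}) m :
  E \subset pairs [set: V] ->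
  (forall i, i \in pairs [set: V] :\: E -> exists K : {set V},
     [/\ #|K| = m.+2, i \subset K & forall j, j \in pairs K -> j \in E \/ j = i]) ->
  'C(#|V|, 2) <= #|E| + 'C(#|V| - m, 2).
Proof.
move=> sE sat; set P := pairs _ :\: E in sat.
have <- : #|E| + #|P| = 'C(#|V|, 2).
  by rewrite -cardsT -card_pairs -(cardsID E (pairs _)) (setIidPr sE).
rewrite leq_add2l.
pose good (i K : {set V}) := [&& #|K| == m.+2, i \subset K &
  [forall j in pairs K, (j \in E) || (j == i)]].
pose K i := odflt set0 [pick K | good i K].
have KP i : i \in P -> good i (K i).
  move=> iP; rewrite /K; case: pickP => //= none.
  have [K0 [cK iK jK]] := sat i iP; have := none K0.
  rewrite /good cK iK eqxx /= => /negP; case.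
  by apply/forall_inP => j /jK[->|->] //; rewrite eqxx orbT.
have cP i : i \in P -> #|i| = 2 by rewrite !inE => /andP[_ /andP[_ /eqP]].
have [->|/set0Pn[i0 i0P]] := eqVneq P set0; first by rewrite cards0.
have mV : m.+2 <= #|V|.
  by have /and3P[/eqP<- _ _] := KP _ i0P; rewrite max_card.
have cB i : i \in P -> #|~: K i| = #|V| - m.+2.
  by move=> iP; have /and3P[/eqP<- _ _] := KP _ iP; rewrite cardsCs setCK.
have bol : (\sum_(i in P) bollobas_weight #|i| #|~: K i| <= 1)%R.
  apply: (@bollobas _ _ id (fun i => ~: K i) [set: V]).
    move=> i iP; split; rewrite ?subsetT //.
    by rewrite disjoints_subset setCK; have /and3P[] := KP _ iP.
  move=> i j iP jP ij; rewrite disjoints_subset setCK; apply/negP => iK.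
  have /and3P[_ _ /forall_inP /(_ i)] := KP _ jP.
  rewrite inE iK cP // eqxx (negPf ij) orbF => /(_ isT) iE.
  by move: iP; rewrite inE iE.
rewrite (eq_bigr (fun=> bollobas_weight 2 (#|V| - m.+2))) in bol; last first.
  by move=> i iP; rewrite cP // cB.
move: bol; rewrite GRing.sumr_const -GRing.mulr_natl /bollobas_weight.
have -> : 2 + (#|V| - m.+2) = #|V| - m by lia.
rewrite Num.Theory.ler_pdivrMr ?Num.Theory.ltr0n ?bin_gt0 ?leq_subRL; try lia.
by rewrite GRing.mul1r Num.Theory.ler_nat.
Qed.


(** * From graphs to edge sets *)

Section Graphs.
Variables (V : finType).
Implicit Type (G : graph V).

Lemma edges_adj G x y : ([set x; y] \in edges G) = adj G x y.
Proof.
apply/imsetP/idP => [[[a b]]|xy]; last by exists (x, y); rewrite ?inE.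
rewrite inE /= => ab e.
have xab : x \in [set a; b] by rewrite -e !inE eqxx.
have yab : y \in [set a; b] by rewrite -e !inE eqxx orbT.
have axy : a \in [set x; y] by rewrite e !inE eqxx.
have bxy : b \in [set x; y] by rewrite e !inE eqxx orbT.
have nab : a != b by apply: contraTneq ab => ->; rewrite adj_irr.
case/set2P: xab axy bxy => ->; case/set2P: yab => -> //; rewrite ?(adj_sym G b) //.
  by move=> _ /set2P[]/esym/eqP; rewrite (negPf nab).
by move=> /set2P[]/eqP; rewrite (negPf nab).
Qed.

Lemma edgesP G e : reflect (exists x y, adj G x y /\ e = [set x; y]) (e \in edges G).
Proof.
apply: (iffP imsetP) => [[[x y]]|[x [y [xy ->]]]].
  by rewrite inE /= => xy ->; exists x, y.
by exists (x, y); rewrite ?inE.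
Qed.

Lemma edges_pairs G : edges G \subset pairs [set: V].
Proof.
apply/subsetP => e /edgesP[x [y [xy ->]]]; rewrite inE subsetT cards2.
by rewrite (contraTneq _ xy) // => ->; rewrite adj_irr.
Qed.

End Graphs.

(** * Copies of complete graphs and of matchings; the graphs $S_{n,m}$ *)

Section Copies.
Variable V : finType.
Implicit Type G : graph V.

Definition clique G (K : {set V}) := {in K &, forall x y, x != y -> adj G x y}.

Lemma contains_complete G s :
  contains (complete s) G <-> exists2 K : {set V}, #|K| = s & clique G K.
Proof.
split=> [[S]|[K cK clK]].
  rewrite inE => /andP[/andP[sub _] /existsP[f /and3P[/injectiveP inj /eqP S1 /eqP S2]]].
  exists (f @: [set: 'I_s]); first by rewrite card_imset // cardsT card_ord.
  move=> _ _ /imsetP[i _ ->] /imsetP[j _ ->] ij.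
  rewrite -edges_adj; apply: (subsetP sub); rewrite S2.
  have -> : [set f i; f j] = f @: [set i; j] by rewrite imsetU1 imset_set1.
  apply: imset_f; rewrite edges_adj /= /complete_rel.
  by apply: contraNneq ij => ->.
pose f := [ffun i : 'I_s => enum_val (cast_ord (esym cK) i)].
have fK i : f i \in K by rewrite ffunE enum_valP.
have inj : injective f by move=> i j; rewrite !ffunE => /enum_val_inj/cast_ord_inj.
exists (K, [set f @: (e : {set 'I_s}) | e in edges (complete s)]).
rewrite inE /is_subgraph /subgraph_iso /=; apply/andP; split; last first.
  apply/existsP; exists f; apply/and3P; split=> //; first exact/injectiveP.
  rewrite eq_sym eqEcard card_imset // cardsT card_ord cK leqnn andbT.
  by apply/subsetP => _ /imsetP[i _ ->].
apply/andP; split.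
  apply/subsetP => _ /imsetP[e /edgesP[i [j [ij ->]]] ->].
  rewrite imsetU1 imset_set1 edges_adj; apply: clK => //.
  by apply: contra_neq ij => /inj.
by apply/forall_inP => _ /imsetP[e _ ->]; apply/subsetP => _ /imsetP[i _ ->].
Qed.

(** The graph $M_k$ has no isolated vertex, so the vertex set of a copy is the cover of its edge
    set, and a copy is determined by its edges. *)
Lemma card_copies_matching G k : num_copies (matching k) G = #|matchings (edges G) k|.
Proof.
rewrite /num_copies.
have mE e : reflect (exists i : 'I_k, e = [set (i, false); (i, true)]) (e \in edges (matching k)).
  apply: (iffP (edgesP _ _)) => [[[i a] [[j b] [/= /andP[/= /eqP<- ab] ->]]]|[i ->]].
    by exists i; case: a b ab => [] [] //; rewrite setUC.
  by exists (i, false), (i, true); rewrite /= /matching_rel /= eqxx.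
have copyP S : S \in copies (matching k) G -> 
    S.1 = cover S.2 /\ S.2 \in matchings (edges G) k.
  rewrite inE => /andP[/andP[sub _] /existsP[f /and3P[/injectiveP inj /eqP S1 /eqP S2]]].
  pose g (i : 'I_k) := [set f (i, false); f (i, true)].
  have S2g : S.2 = [set g i | i : 'I_k].
    rewrite S2; apply/setP => e; apply/imsetP/imsetP.
      by move=> [_ /mE[i ->] ->]; exists i; rewrite // imsetU1 imset_set1.
    move=> [i _ ->]; exists [set (i, false); (i, true)]; first by apply/mE; exists i.
    by rewrite imsetU1 imset_set1.
  have dj i j : i != j -> [disjoint g i & g j].
    move=> ij; rewrite -setI_eq0; apply/eqP/setP => x; rewrite !inE.
    apply/negP => /andP[/orP[]/eqP-> /orP[]/eqP/inj[]/eqP]; by rewrite (negPf ij).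
  have ginj : injective g.
    move=> i j gij; apply/eqP; apply: contraT => /dj; rewrite gij -setI_eq0 setIid.
    by move=> /eqP/setP/(_ (f (j, false))); rewrite !inE eqxx.
  split.
    rewrite S1; apply/setP => x; apply/imsetP/bigcupP.
      move=> [[i b] _ ->]; exists (g i); first by rewrite S2g imset_f.
      by rewrite !inE; case: b; rewrite eqxx ?orbT.
    move=> [e]; rewrite S2g => /imsetP[i _ ->]; rewrite !inE.
    by move=> /orP[]/eqP->; eexists.
  rewrite inE sub S2g card_imset // cardT size_enum_ord eqxx andbT /=.
  apply/trivIsetP => _ _ /imsetP[i _ ->] /imsetP[j _ ->] ij.
  by apply: dj; apply: contra_neq ij => ->.
rewrite -(card_in_imset (f := snd)); last first.
  move=> [S1 S2] [S1' S2'] /copyP[/= -> _] /copyP[/= -> _] -> //.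
apply: eq_card => M; apply/imsetP/idP => [[S /copyP[_ SM] ->] //|MM].
exists (cover M, M) => //; move: MM; rewrite inE => /and3P[sM tM /eqP cM].
pose g (i : 'I_k) := enum_val (cast_ord (esym cM) i).
have gM i : g i \in M by apply: enum_valP.
have gpair i : exists p : V * V, p.1 != p.2 /\ g i = [set p.1; p.2].
  have [_ /eqP/cards2P[x [y [xy e]]]] := pairs_sub (edges_pairs G) sM (gM i).
  by exists (x, y).
(* An order of the two endpoints is chosen for every edge; this turns a matching into an embedding
   of ['I_k * bool]. *)
have [p pP] := fin_all_exists gpair.
have ginj : injective g by move=> i j /enum_val_inj/cast_ord_inj.
pose f := [ffun q : 'I_k * bool => if q.2 then (p q.1).2 else (p q.1).1].
have fg i b : f (i, b) \in g i.
  by rewrite ffunE /=; have [_ ->] := pP i; case: b; rewrite !inE eqxx ?orbT.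
have fE i : f @: [set (i, false); (i, true)] = g i.
  by rewrite imsetU1 imset_set1 !ffunE /=; have [_ ->] := pP i.
have gsurj e : e \in M -> exists i, e = g i.
  move=> eM; exists (cast_ord cM (enum_rank_in eM e)).
  by rewrite /g cast_ordK enum_rankK_in.
have finj : injective f.
  move=> [i a] [j b] eq.
  have ij : i = j.
    apply: ginj; apply/eqP; apply: contraT => ne.
    have := trivIsetP tM _ _ (gM i) (gM j) ne => /disjointFr /(_ (fg i a)).
    by rewrite eq fg.
  rewrite ij in eq *; have [ne _] := pP j; move: eq ne; rewrite !ffunE /=.
  by case: a b => [] [] // ->; rewrite eqxx.
rewrite inE /is_subgraph sM /=; apply/andP; split.
  by apply/forall_inP => e eM; apply: (bigcup_sup e).
apply/existsP; exists f; apply/and3P; split; first exact/injectiveP.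
  apply/eqP/setP => x; apply/bigcupP/imsetP => /=.
    move=> [e /gsurj[i ->]]; rewrite -fE => /imsetP[q _ ->]; by exists q; rewrite ?inE.
  by move=> [[i b] _ ->]; exists (g i); [exact: gM | exact: fg].
apply/eqP/setP => e; apply/idP/imsetP => /=.
  move=> /gsurj[i ->]; exists [set (i, false); (i, true)]; last by rewrite fE.
  by apply/mE; exists i.
by move=> [_ /mE[i ->] ->]; rewrite fE.
Qed.

(** This is $S_{n,m}$ with [B] as its clique on [m] vertices; naming [B] avoids carrying an
    isomorphism. *)
Definition split_on (B : {set V}) G :=
  forall x y, adj G x y = (x != y) && ((x \in B) || (y \in B)).

(** A clique has at most one vertex outside [B], while a new edge outside [B] completes a clique
    together with [B]. *)
Lemma split_on_saturated B G : split_on B G -> saturated (complete #|B|.+2) G.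
Proof.
move=> sp; split.
  move/contains_complete => [K cK clK].
  have : 1 < #|K :\: B|.
    have := cardsID B K; have := subset_leq_card (subsetIr K B); rewrite cK.
    by move: #|K :&: B| #|K :\: B| #|B| => a b c; lia.
  move=> /card_gt1P[x [y [/setDP[xK xB] /setDP[yK yB] xy]]].
  by have := clK x y xK yK xy; rewrite sp (negPf xB) (negPf yB) andbF.
move=> x y xy; rewrite sp xy /= negb_or => /andP[xB yB].
apply/contains_complete; exists (x |: (y |: B)).
  by rewrite !cardsU1 !inE negb_or xy xB yB.
have sx z w : z \in B -> w != z -> add_edge_rel G x y z w.
  by move=> zB wz; rewrite /add_edge_rel sp eq_sym wz zB.
move=> u v uK vK uv /=.
case: (boolP (u \in B)) => uB; first by apply: sx => //; rewrite eq_sym.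
case: (boolP (v \in B)) => vB; first by rewrite add_edge_sym; apply: sx.
move: uK vK; rewrite !inE (negPf uB) (negPf vB) !orbF.
rewrite /add_edge_rel; move=> /orP[]/eqP eu /orP[]/eqP ev; move: uv; rewrite eu ev ?eqxx //.
  by move=> ->; rewrite orbT.
by move=> ->; rewrite setUC eqxx orbT.
Qed.

Lemma split_on_num_copies B G k : split_on B G ->
  num_copies (matching k) G <= split_matchings #|B| #|V| k.
Proof.
move=> sp; rewrite card_copies_matching -cardsT.
apply: matchings_le_split; rewrite ?subsetT ?edges_pairs //.
move=> e /edgesP[x [y [+ ->]]]; rewrite sp => /andP[_ /orP[]zB].
  by apply/negP => dj; move: (disjointFr dj (set21 x y)); rewrite zB.
by apply/negP => dj; move: (disjointFr dj (set22 x y)); rewrite zB.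
Qed.

End Copies.


(** * Recognising $S_{n,m}$, and consequences of saturation *)

Lemma card_ord_ltn n m : m <= n -> #|[set i : 'I_n | i < m]| = m.
Proof.
move=> mn; rewrite -[RHS]card_ord -cardsT -(card_imset _ (f := widen_ord mn)); last first.
  by move=> i j /(congr1 val) /= /val_inj.
apply: eq_card => i; rewrite inE; apply/idP/imsetP => [im|[j _ ->]].
  by exists (Ordinal im) => //; apply: val_inj.
exact: (ltn_ord j).
Qed.

Lemma isomorphic_split_on n m (G : graph 'I_n) : m <= n ->
  isomorphic G (clique_join_empty n m) <-> exists2 B : {set 'I_n}, #|B| = m & split_on B G.
Proof.
move=> mn; split=> [[f bf fG]|[B cB sp]].
  exists (f @^-1: [set i : 'I_n | i < m]).
    by rewrite on_card_preimset ?card_ord_ltn //; apply: onW_bij.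
  by move=> x y; rewrite -fG /= /clique_join_empty_rel !inE (inj_eq (bij_inj bf)).
(* With [B] listed first, the position in [l] is the isomorphism. *)
pose l := enum B ++ enum (~: B).
have ml x : x \in l by rewrite mem_cat !mem_enum inE orbN.
have sl : size l = n by rewrite size_cat -!cardE cardsC card_ord.
have lt x : index x l < n by rewrite -[X in _ < X]sl index_mem.
pose f x := Ordinal (lt x).
have inj : injective f.
  by move=> x y /(congr1 val) /=; apply: index_inj; rewrite ?ml.
have fB x : (f x < m) = (x \in B).
  rewrite /= index_cat mem_enum; case: ifP => xB.
    by rewrite -cB cardE index_mem mem_enum.
  by rewrite -cB cardE ltnNge leq_addr.
exists f; first exact: injF_bij.
by move=> x y; rewrite sp /= /clique_join_empty_rel (inj_eq inj) !fB.
Qed.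

(** A clique created by the new edge must contain both its ends, as it would otherwise be a clique
    of [G]. *)
Lemma saturated_nonadj (V : finType) (G : graph V) m x y :
  saturated (complete m.+2) G -> x != y -> ~~ adj G x y ->
  exists2 K : {set V}, #|K| = m.+2 /\ [set x; y] \subset K &
    {in K &, forall u v, u != v -> adj G u v \/ [set u; v] = [set x; y]}.
Proof.
move=> [free sat] xy nxy; have /contains_complete[K cK clK] := sat x y xy nxy.
have adjK : {in K &, forall u v, u != v -> adj G u v \/ [set u; v] = [set x; y]}.
  move=> u v uK vK uv; have := clK u v uK vK uv; rewrite /= /add_edge_rel uv /=.
  by move=> /orP[|/eqP->]; [left|right].
exists K => //; split=> //; apply/negPn/negP => xyK.
case: free; apply/contains_complete; exists K => // u v uK vK uv.
have [//|uvxy] := adjK u v uK vK uv.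
by case/negP: xyK; rewrite -uvxy subUset !sub1set uK.
Qed.

(** The set-pair bound allows ['C(#|V| - m, 2)] non-edges, exactly as many as $S_{n,m}$ has. *)
Lemma saturated_edges_lower (V : finType) (G : graph V) m :
  saturated (complete m.+2) G -> m <= #|V| ->
  split_matchings m #|V| 1 <= #|edges G|.
Proof.
move=> sat mV.
rewrite -(leq_add2r 'C(#|V| - m, 2)) split_matchings1 //.
apply: saturated_card_edges; first exact: edges_pairs.
move=> i; rewrite !inE => /andP[iE /andP[_ /cards2P[x [y [xy e]]]]].
rewrite e edges_adj in iE.
have [K [cK xyK] adjK] := saturated_nonadj sat xy iE.
exists K; split; rewrite ?e // => j.
rewrite inE => /andP[jK /cards2P[u [v [uv ej]]]].
move: jK; rewrite ej subUset !sub1set edges_adj => /andP[uK vK].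
exact: adjK.
Qed.

(** Two adjacent vertices outside [B] would form a forbidden clique together with [B]. *)
Lemma dominating_split_on (V : finType) (G : graph V) (B : {set V}) :
  ~ contains (complete #|B|.+2) G ->
  (forall b x, b \in B -> b != x -> adj G b x) -> split_on B G.
Proof.
move=> free dom x y; have [->|xy] /= := eqVneq x y; first by rewrite adj_irr.
case: (boolP (x \in B)) => xB; first exact: dom.
case: (boolP (y \in B)) => yB; first by rewrite adj_sym dom // eq_sym.
apply/negP => axy; apply: free; apply/contains_complete.
exists (x |: (y |: B)); first by rewrite !cardsU1 !inE negb_or xy xB yB.
move=> u v; rewrite !inE.
case: (boolP (u \in B)) => uB; first by move=> _ _; apply: dom.
case: (boolP (v \in B)) => vB.
  by move=> _ _ uv; rewrite adj_sym dom // eq_sym.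
rewrite !orbF => /orP[]/eqP-> /orP[]/eqP->; rewrite ?eqxx //.
by rewrite adj_sym.
Qed.

(** * The choice of constants *)

Lemma bin_leq_expn2 n k : 'C(n, k) <= 2 ^ n.
Proof.
elim: n k => [|n IH] [|k] //; first by rewrite bin0 expn_gt0.
by rewrite binS expnS mul2n -addnn leq_add.
Qed.

(** The binomials differ by at least 1. By Bernoulli, replacing [n] by [p] costs at most
    ['C(m.+1, j) * j * (n - p) / n] in units of [n ^ j], which is below 1. *)
Lemma binom_gap_holds n p M m j : 0 < j <= m.+1 -> m < M -> p <= n ->
  2 ^ M * M * (n - p) < n -> 'C(m, j) * n ^ j < 'C(m.+1, j) * p ^ j.
Proof.
move=> /andP[j0 jm] mM pn big.
have n0 : 0 < n by apply: leq_trans big.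
rewrite -(ltn_pmul2l n0).
have B := @expn_sub_bernoulli n (n - p) j (leq_subr _ _); rewrite subKn // in B.
set c := 'C(m.+1, j).
have cc : 'C(m, j) < c.
  by rewrite /c; case: j j0 jm {B c} => // j _ jm; rewrite binS -addn1 leq_add2l bin_gt0.
have h1 : c * (j * (n - p) * n ^ j) < n * n ^ j.
  rewrite !mulnA ltn_pmul2r ?expn_gt0 ?n0 //; apply: leq_ltn_trans big.
  rewrite leq_mul2r; apply/orP; right; apply: leq_mul; last by apply: leq_trans jm _.
  by apply: leq_trans (bin_leq_expn2 _ _) _; rewrite leq_exp2l.
have h2 : c * n ^ j.+1 <= c * (n * p ^ j + j * (n - p) * n ^ j) by rewrite leq_mul2l B orbT.
have h3 : 'C(m, j).+1 * n ^ j.+1 <= c * n ^ j.+1 by rewrite leq_mul2r cc orbT.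
have e : n * (c * p ^ j) = c * (n * p ^ j) by rewrite mulnCA.
have e2 : n * ('C(m, j) * n ^ j) = 'C(m, j) * n ^ j.+1 by rewrite mulnCA expnS.
rewrite e e2; move: h2 h3; rewrite mulnDr mulSn expnS.
rewrite expnS in e2.
move: h1; move: (n * n ^ j) => Y.
move: (c * (j * _ * _)) (c * (n * p ^ j)) (c * Y) ('C(_, _) * Y) => *; lia.
Qed.

Lemma large_constants m R : 0 < m -> 0 < R -> exists N, forall n, N <= n ->
  exists h g, [/\ 0 < g, R * g < n &
    forall q, q * h <= 2 * (m * n) -> m ^ 2 + q ^ 2 + m * h <= g].
Proof.
(* With [h] just above [n / K], at most [2 * m * K] vertices are large, a constant. Then [g] is [c]
   plus at most [n / (2 * R)], so [R * g < n] once [n > 2 * R * c]. *)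
move=> m0 R0; pose K := 2 * R * m; pose c := m ^ 2 + (2 * m * K) ^ 2 + m.
exists (2 * R * c).+1 => n hn.
have K0 : 0 < K by rewrite /K !muln_gt0 R0 m0.
pose h := (n %/ K).+1; exists h, (c + m * (n %/ K)); split.
- by rewrite /c addn_gt0 addn_gt0 m0 orbT.
- have : K * (n %/ K) <= n by rewrite mulnC leq_divM.
  rewrite /K mulnDr; have -> : 2 * R * m * (n %/ (2 * R * m)) = 2 * (R * (m * (n %/ K))) by rewrite !mulnA.
  by move: hn; rewrite -mulnA; move: (R * c) (R * (m * _)) => x y; lia.
move=> q hq.
have qK : q <= 2 * m * K.
  have : q * h <= 2 * m * K * h.
    apply: leq_trans hq _; rewrite mulnA -[leqRHS]mulnA leq_mul2l.
    by apply/orP; right; rewrite mulnC ltnW // ltn_ceil.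
  by rewrite leq_pmul2r.
have : q ^ 2 <= (2 * m * K) ^ 2 by rewrite leq_exp2r.
rewrite /c /h mulnS; move: (q ^ 2) ((2 * m * K) ^ 2) (m ^ 2) (m * _) => *; lia.
Qed.

Lemma exists_subset_card (T : finType) (A : {set T}) j :
  j <= #|A| -> exists2 B : {set T}, B \subset A & #|B| = j.
Proof.
move=> jA; exists [set x in take j (enum A)].
  by apply/subsetP => x; rewrite inE => /mem_take; rewrite mem_enum.
rewrite cardsE; apply/eqP; rewrite (card_uniqP _) ?take_uniq ?enum_uniq //.
by rewrite size_takel // -cardE.
Qed.

Lemma star_sub (V : finType) (E1 E2 : {set {set V}}) v :
  E1 \subset E2 -> #|star E1 v| <= #|star E2 v|.
Proof.
move=> s; apply: subset_leq_card; apply/subsetP => e; rewrite !inE => /andP[eE ->].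
by rewrite (subsetP s).
Qed.

Lemma full_degree_adj (V : finType) (G : graph V) b x :
  #|V|.-1 <= #|star (edges G) b| -> b != x -> adj G b x.
Proof.
move=> deg bx; apply: contraT => nadj.
have := @card_star_disjoint _ setT (edges G) b [set x] (edges_pairs G) (in_setT _) _.
rewrite sub1set !inE eq_sym bx cards1 cardsT => /(_ isT).
have -> : [set e in star (edges G) b | [disjoint e & [set x]]] = star (edges G) b.
  apply/setP => e; rewrite !inE; apply: andb_idr => /andP[eE be].
  rewrite disjoint_sym disjoints1; apply: contra nadj => xe.
  have [_ /eqP ce] := pairs_sub (edges_pairs G) (subxx _) eE.
  rewrite -edges_adj; suff <- : e = [set b; x] by [].
  by apply/eqP; rewrite eq_sym eqEcard subUset !sub1set be xe (eqP ce) cards2 bx.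
have V2 : 1 < #|V| by apply/card_gt1P; exists b, x.
move: deg V2; move: #|star _ _| #|V| => a c; lia.
Qed.

(** * The case [k <= m] for large [n] *)

Lemma saturated_matchings m k : 1 < k <= m -> exists N, forall (V : finType) (G : graph V),
  N <= #|V| -> saturated (complete m.+2) G ->
  split_matchings m #|V| k <= #|matchings (edges G) k| /\
  (#|matchings (edges G) k| <= split_matchings m #|V| k ->
    exists2 B : {set V}, #|B| = m & split_on B G).
Proof.
move=> /andP[k1 km].
have m0 : 0 < m by apply: leq_trans km; apply: ltnW.
pose Q := 2 ^ m * m; pose a := 16 * m ^ 3.
pose c := a + m.*2.+1; pose R := Q * c + 6 * m + c.
have R0 : 0 < R by rewrite /R !addn_gt0 muln_gt0 m0 orbT.
have [N hN] := large_constants m0 R0.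
exists N => V G nV sat; move: (hN _ nV) => [h [g [g0 Rg hg]]].
set E := edges G; set n := #|V| in nV Rg hg *.
(* The deletion argument runs with [T = a * g] and [p = n - D]; this [D] is the least with
   [p + T + 2m + 1 <= n]. The constant [R] makes [Q * D < n], as [binom_gap_holds] requires. *)
set D := a * g + m.*2.+1.
have Dg : D <= c * g by rewrite mulnDl leq_add2l leq_pmulr.
have [QD mg Dn] : [/\ Q * D < n, 6 * m * g <= n & D <= n].
  have : Q * D <= Q * (c * g) by rewrite leq_mul2l Dg orbT.
  move: Rg Dg; rewrite /R (mulnDl _ c) (mulnDl (Q * c)) -(mulnA Q).
  move: (Q * (c * g)) (Q * D) (6 * m * g) (c * g) => x y z t *; split; lia.
have mn : m <= n by apply: leq_trans Dn; rewrite /D -addnn; lia.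
have cE : split_matchings m n 1 <= #|E| := saturated_edges_lower sat mn.
have sE : E \subset pairs setT := edges_pairs G.
(* The greedy count needs an upper bound on the number of edges too, so [E] is trimmed to the edge
   number of $S_{n,m}$. Large degrees in [E0] remain large in [E]. *)
have [E0 sE0 cE0] := exists_subset_card cE.
have sE0p := subset_trans sE0 sE.
have mV1 : m * n <= #|E0| + m ^ 2 by rewrite cE0; apply: split_matchings1_ge.
have mV2 : #|E0| <= m * n by rewrite cE0; apply: leq_trans (split_matchings_le _ _ _) _; rewrite bin1.
have hk : 1 < k <= m by rewrite k1.
have [big|cH] := many_large_degrees sE0p (erefl n) hk g0 mg mV1 mV2 hg.
  have lt : split_matchings m n k < #|matchings E k|.
    apply: leq_ltn_trans (split_matchings_le _ _ _) _.
    exact: leq_trans big (matchings_sub k sE0).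
  by split; [exact: ltnW | rewrite leqNgt lt].
have [B sB cB] := exists_subset_card cH.
have deg b : b \in B -> n <= #|star E b| + (a * g).+1.
  move=> /(subsetP sB); rewrite inE => /leq_trans; apply.
  by rewrite leq_add2r star_sub.
have gap m' j : 0 < j <= m'.+1 -> m' < m -> 'C(m', j) * n ^ j < 'C(m'.+1, j) * (n - D) ^ j.
  by move=> hj hm; apply: (binom_gap_holds hj hm); rewrite ?leq_subr // subKn.
have [k' kk] : exists k', k = k'.+1 by exists k.-1; lia.
have cB' : #|B| <= m by rewrite cB.
have nT : #|[set: V]| = n by rewrite cardsT.
have hp : n - D + a * g + (#|B|.*2).+1 <= #|[set: V]| by rewrite nT cB /D; lia.
have nT' : #|[set: V]| <= n by rewrite nT.
have deg' b : b \in B -> #|[set: V]| <= #|star E b| + (a * g).+1 by rewrite nT; exact: deg.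
rewrite kk; split.
  have := @card_matchings_ge V n m _ gap (a * g) setT B E 0 k' sE (subsetT _) cB' nT' deg' hp.
  by rewrite cB nT addn0 mul0n addn0; apply.
(* A vertex of [B] with a missing edge would force strictly more matchings, so every vertex of [B]
   is adjacent to all others. *)
move=> le; exists B => //; apply: dominating_split_on; first by rewrite cB; case: sat.
move=> b x bB; apply: full_degree_adj; rewrite leqNgt; apply/negP => db.
have := @card_matchings_gt V n m _ gap (a * g) setT B E k' sE (subsetT _) cB' nT' deg' hp.
rewrite cB nT => /(_ cE) gt; move: le; rewrite leqNgt gt //; first by lia.
by exists b.
Qed.

(** * Uniqueness for triangles and 2-matchings *)

Lemma disjoint_edges_matching (V : finType) (G : graph V) a b c d :
  adj G a b -> adj G c d -> [disjoint [set a; b] & [set c; d]] ->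
  0 < #|matchings (edges G) 2|.
Proof.
move=> ab cd dj; apply/card_gt0P; exists ([set a; b] |: [set [set c; d]]).
have t1 : trivIset [set [set c; d]].
  by apply/trivIsetP => A B; rewrite !inE => /eqP-> /eqP->; rewrite eqxx.
have e0 : #|[set a; b]| != 0 by rewrite cards2.
have [|t n] := trivIsetU1 e0 t1; first by rewrite cover1.
by rewrite inE t cardsU1 n cards1 subUset !sub1set !edges_adj ab cd.
Qed.

(** Any two edges meet, so it suffices to find a dominating vertex; an endpoint of any edge [u0 v0]
    will do, for failures at both ends produce two disjoint edges. *)
Lemma saturated_triangle_star (V : finType) (G : graph V) :
  0 < #|V| -> saturated (complete 3) G -> #|matchings (edges G) 2| = 0 ->
  exists2 B : {set V}, #|B| = 1 & split_on B G.
Proof.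
move=> V0 sat M0.
suff [u dom] : exists u, forall x, u != x -> adj G u x.
  exists [set u]; first by rewrite cards1.
  apply: dominating_split_on; first by rewrite cards1; case: sat.
  by move=> b x; rewrite inE => /eqP->; exact: dom.
have nodisj a b c d : adj G a b -> adj G c d -> [disjoint [set a; b] & [set c; d]] -> False.
  by move=> ab cd /(disjoint_edges_matching ab cd); rewrite M0.
have nbr x y : x != y -> exists z, adj G x z.
  move=> xy; case: (boolP (adj G x y)) => axy; first by exists y.
  have [K [cK xyK] adjK] := saturated_nonadj sat xy axy.
  have : 0 < #|K :\: [set x; y]| by rewrite cardsDS // cK cards2 xy.
  move=> /card_gt0P[z]; rewrite !inE negb_or => /andP[/andP[zx zy] zK].
  have xK : x \in K by apply: (subsetP xyK); rewrite set21.
  have xz : x != z by rewrite eq_sym.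
  exists z; have [//|e] := adjK x z xK zK xz.
  by have := set22 x z; rewrite e !inE (negPf zx) (negPf zy).
have /card_gt0P[u0 _] := V0.
case: (boolP [forall x, (u0 != x) ==> adj G u0 x]) => [/forallP d|].
  by exists u0 => x; apply/implyP.
case/forallPn => y0; rewrite negb_imply => /andP[uy0 _].
have [v0 uv] := nbr _ _ uy0.
case: (boolP [forall x, (u0 != x) ==> adj G u0 x]) => [/forallP d|].
  by exists u0 => x; apply/implyP.
case: (boolP [forall x, (v0 != x) ==> adj G v0 x]) => [/forallP d|].
  by exists v0 => x; apply/implyP.
(* The vertex [w] has some edge, which must meet [a b] and cannot do so at [a]. *)
have other a b w : adj G a b -> a != w -> ~~ adj G a w -> adj G w b.
  move=> ab aw naw; have [z wz] : exists z, adj G w z by apply: (nbr w a); rewrite eq_sym.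
  have bw : b != w by apply: contraNneq naw => <-.
  case: (eqVneq z b) => [<- //|zb].
  case: (eqVneq z a) wz => [->|za wz]; first by rewrite adj_sym (negPf naw).
  case: (nodisj a b w z) => //; rewrite -setI_eq0; apply/eqP/setP => t.
  rewrite !inE; apply/negP => /andP[/orP[]/eqP-> /orP[]].
  - by rewrite (negPf aw).
  - by rewrite eq_sym (negPf za).
  - by rewrite (negPf bw).
  - by rewrite eq_sym (negPf zb).
case/forallPn => w; rewrite negb_imply => /andP[vw nvw].
case/forallPn => x; rewrite negb_imply => /andP[ux nux].
have vu : adj G v0 u0 by rewrite adj_sym.
have wu := other _ _ _ vu vw nvw.
have xv := other _ _ _ uv ux nux.
case: (nodisj _ _ _ _ wu xv); rewrite -setI_eq0; apply/eqP/setP => t.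
rewrite !inE; apply/negP => /andP[/orP[]/eqP-> /orP[]/eqP e].
- by move: nux; rewrite -e adj_sym wu.
- by move: vw; rewrite e eqxx.
- by move: ux; rewrite e eqxx.
- by move: uv; rewrite e adj_irr.
Qed.

(** * From the lower bound to the saturation number and its extremal graphs *)

Section Extremal.
Variables n m k : nat.
Hypothesis mn : m <= n.
Let S := clique_join_empty n m.

Lemma clique_join_empty_split_on : exists2 B : {set 'I_n}, #|B| = m & split_on B S.
Proof. by apply/isomorphic_split_on => //; exists id => //; exists id. Qed.

Hypothesis lower : forall G : graph 'I_n, saturated (complete m.+2) G ->
  split_matchings m n k <= num_copies (matching k) G.

Lemma split_on_extremal (G : graph 'I_n) (B : {set 'I_n}) : #|B| = m -> split_on B G ->
  saturated (complete m.+2) G /\ num_copies (matching k) G = split_matchings m n k.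
Proof.
move=> cB sp; have sat : saturated (complete m.+2) G by rewrite -cB; apply: split_on_saturated.
split=> //; apply/eqP; rewrite eqn_leq lower // andbT.
by have := split_on_num_copies k sp; rewrite cB card_ord.
Qed.

Lemma is_sat_clique_join_empty :
  is_sat n (matching k) (complete m.+2) (num_copies (matching k) S).
Proof.
have [B cB sp] := clique_join_empty_split_on.
have [sat num] := split_on_extremal cB sp.
by split=> [|G satG]; [exists S | rewrite num lower].
Qed.

(** Since $S_{n,m}$ attains the bound [lower], an extremal graph has exactly that many copies, and
    [rigid] then identifies it. *)
Lemma sat_extremal_isomorphic (G : graph 'I_n) :
  (saturated (complete m.+2) G -> num_copies (matching k) G <= split_matchings m n k ->
   exists2 B : {set 'I_n}, #|B| = m & split_on B G) ->
  sat_extremal (matching k) (complete m.+2) G <-> isomorphic G S.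
Proof.
move=> rigid; rewrite isomorphic_split_on //; split=> [[sat ext]|[B cB sp]].
  apply: rigid => //; rewrite (is_sat_unique ext is_sat_clique_join_empty).
  have [B cB sp] := clique_join_empty_split_on.
  by have [_ ->] := split_on_extremal cB sp.
have [sat num] := split_on_extremal cB sp; split=> //.
have [B' cB' sp'] := clique_join_empty_split_on.
have [_ num'] := split_on_extremal cB' sp'.
by rewrite num -num'; exact: is_sat_clique_join_empty.
Qed.
End Extremal.

Theorem theorem1p3 (s k : nat) (hs : 3 <= s) (hk : 2 <= k) :
  (exists N : nat, forall n : nat, N <= n ->
     is_sat n (matching k) (complete s)
       (num_copies (matching k) (clique_join_empty n (s - 2)))
     /\ (k <= s - 2 ->
         forall G : graph 'I_n,
           sat_extremal (matching k) (complete s) G <->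
           isomorphic G (clique_join_empty n (s - 2))))
  /\ (s = 3 -> k = 2 ->
      forall n : nat, 1 <= n ->
      forall G : graph 'I_n,
        sat_extremal (matching k) (complete s) G <->
        isomorphic G (clique_join_empty n 1)).
Proof.
have [m ->] : exists m, s = m.+2 by exists (s - 2); lia.
rewrite subSS subSS subn0; split; last first.
  move=> [m1] k2 n n1 G; rewrite m1 k2; apply: sat_extremal_isomorphic => //.
    (* Here the lower bound is 0, because ['C(1, 2) = 0]. *)
    by move=> G' _; apply: leq_trans (split_matchings_le _ _ _) _.
  move=> sat; rewrite card_copies_matching => le.
  have V0 : 0 < #|'I_n| by rewrite card_ord.
  apply: saturated_triangle_star => //.
  by apply/eqP; rewrite -leqn0; apply: leq_trans le (split_matchings_le _ _ _).
(* For [k > m] the minimum is 0, attained by $S_{n,m}$ as soon as [m <= n], and the uniqueness claim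
   is vacuous. *)
case: (leqP k m) => km; last first.
  exists m => n mn; split; last by [].
  apply: is_sat_clique_join_empty => // G _.
  by apply: leq_trans (split_matchings_le _ _ _) _; rewrite bin_small.
have hkm : 1 < k <= m by rewrite hk.
have [N hN] := saturated_matchings hkm.
exists (N + m) => n nN.
have mn : m <= n by apply: leq_trans nN; apply: leq_addl.
have Nn : N <= #|'I_n| by rewrite card_ord; apply: leq_trans nN; apply: leq_addr.
have lower (G : graph 'I_n) : saturated (complete m.+2) G ->
    split_matchings m n k <= num_copies (matching k) G.
  by move=> /(hN _ _ Nn)[]; rewrite card_ord card_copies_matching.
split; first exact: is_sat_clique_join_empty.
move=> _ G; apply: sat_extremal_isomorphic => // sat.
by have [_] := hN _ _ Nn sat; rewrite card_ord card_copies_matching.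
Qed.
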